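(* Let $0<\lambda<1/2$, and suppose that $\lambda^{-1}$ is a Pisot number. Let $s=r+\alpha>1$, where $r\in\mathbb N$, $r\geq 1$, and $0<\alpha\le1$, and let $h\in C^{r,\alpha}([0,1])$ be a diffeomorphism such that $h'\equiv\eta$ on $X_\lambda$ for some $\eta\neq0$. If, for some $\tau>0$, there is a constant $C>0$ with $$\left|\widehat{h\mu_\lambda}(\xi)\right|\le C|\xi|^{-\tau}\qquad\text{for all }\xi\in\mathbb R\setminus\{0\},$$ then $$\tau\le\frac{\log 2}{(-\log\lambda)\cdot s}.$$ In particular, if $h\in C^\infty([0,1])$ is a diffeomorphism and $h'$ is constant on $X_\lambda$, then $h\mu_\lambda$ cannot have polynomial Fourier decay.
   Context: For $0<\lambda<1/2$, $X_\lambda\subset[0,1]$ is the attractor of $\{e_0,e_1\}$, $e_0(x)=\lambda x$, $e_1(x)=\lambda x+1-\lambda$, i.e. the unique nonempty compact set with $X_\lambda=e_0(X_\lambda)\cup e_1(X_\lambda)$. $\mu_\lambda$ is the Bernoulli convolution: the unique Borel probability measure with $\mu_\lambda=\frac12(e_0)_*\mu_\lambda+\frac12(e_1)_*\mu_\lambda$; its support is $X_\lambda$. $h\mu_\lambda$ denotes the push-forward of $\mu_\lambda$ by $h$. $C^{r,\alpha}$ means $r$ times continuously differentiable with $\alpha$-Hölder $r$-th derivative. The Fourier transform is $\widehat\nu(\xi)=\int e^{-2\pi i\xi t}\,d\nu(t)$. A measure $\nu$ has polynomial Fourier decay if there are $\tau>0$ and $C>0$ with $|\widehat\nu(\xi)|\le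 C|\xi|^{-\tau}$ for all $\xi\ne0$. A Pisot number is a real algebraic integer greater than $1$ all of whose other Galois conjugates have modulus less than $1$. *)

(* Defs.v *)
From HB Require Import structures.
From mathcomp Require Export all_boot all_order all_algebra.
From mathcomp Require Export complex.
From mathcomp Require Export all_classical all_reals all_analysis.

Set Implicit Arguments.
Unset Strict Implicit.
Unset Printing Implicit Defensive.

Import Order.TTheory GRing.Theory Num.Theory.
Import numFieldNormedType.Exports.

Local Open Scope classical_set_scope.
Local Open Scope complex_scope.
Local Open Scope ring_scope.

Section Pisot.
Variable R : rcfType.
Implicit Types (x : R) (z : R[i]).

Definition algebraic_integer x : Prop :=
  exists p : {poly int}, p \is monic /\ root (map_poly intr p) x.

(* An irreducible m : {poly rat} with root x is, up to a scalar, the minimal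
   polynomial of x over the rationals. *)
Definition galois_conjugate x z : Prop :=
  exists m : {poly rat},
    [/\ irreducible_poly m, root (map_poly ratr m) x
      & root (map_poly ratr m) z].

Definition pisot x : Prop :=
  [/\ 1 < x, algebraic_integer x
    & forall z, galois_conjugate x z -> z != x%:C -> `|z| < 1].

End Pisot.

Section SelfSimilar.
Variable R : realType.
Implicit Types (lambda : R) (X : set R).

Definition e0 lambda (x : measurableTypeR R) : measurableTypeR R := lambda * x.
Definition e1 lambda (x : measurableTypeR R) : measurableTypeR R :=
  lambda * x + 1 - lambda.

Definition is_attractor lambda X : Prop :=
  [/\ X !=set0, compact X & X = e0 lambda @` X `|` e1 lambda @` X].

Definition is_bernoulli_convolution lambda
    (mu : probability (measurableTypeR R) R) : Prop :=
  forall A : set (measurableTypeR R), measurable A ->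
    mu A = ((2^-1)%:E * pushforward mu (e0 lambda) A
            + (2^-1)%:E * pushforward mu (e1 lambda) A)%E.

End SelfSimilar.

Section Smoothness.
Variable R : realType.
Implicit Types (A : set R) (f : R -> R) (x : R).

(* Derivatives relative to A: the difference quotient only sees points of A,
   so that the derivative is one-sided at the endpoints of an interval. *)
Definition diff_quotient f x (y : R) : R := (f y - f x) / (y - x).

Definition derivable_on A f : Prop :=
  forall x, A x -> cvg (diff_quotient f x @ within A x^').

Definition derive_on A f : R -> R :=
  fun x => lim (diff_quotient f x @ within A x^').

Definition deriven_on A n f : R -> R := iter n (derive_on A) f.

Definition Cn_on A n f : Prop :=
  (forall k, (k < n)%N -> derivable_on A (deriven_on A k f)) /\
  {within A, continuous (deriven_on A n f)}.

Definition holder_on A (alpha : R) f : Prop :=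
  exists K : R, forall x y, A x -> A y ->
    `|f x - f y| <= K * `|x - y| `^ alpha.

Definition Cn_holder_on A n (alpha : R) f : Prop :=
  Cn_on A n f /\ holder_on A alpha (deriven_on A n f).

Definition Cinfty_on A f : Prop := forall n, Cn_on A n f.

(* Diffeomorphism of A onto its image. *)
Definition diffeo_on A f : Prop :=
  Cn_on A 1 f /\
  exists g : R -> R, Cn_on (f @` A) 1 g /\ forall x, A x -> g (f x) = x.

End Smoothness.

Section Fourier.
Variable R : realType.
Implicit Types (nu : set (measurableTypeR R) -> \bar R).

Definition expi (t : R) : R[i] := cos t +i* sin t.

Definition Cintegral nu (f : R -> R[i]) : R[i] :=
  fine (\int[nu]_t (complex.Re (f t))%:E)
  +i* fine (\int[nu]_t (complex.Im (f t))%:E).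

Definition fourier nu (xi : R) : R[i] :=
  Cintegral nu (fun t => expi (- (2 * pi * xi * t))).

Definition fourier_decay nu (tau C : R) : Prop :=
  forall xi : R, xi != 0 -> `|fourier nu xi| <= (C * `|xi| `^ (- tau))%:C.

Definition polynomial_fourier_decay nu : Prop :=
  exists tau C : R, [/\ 0 < tau, 0 < C & fourier_decay nu tau C].

(* The push-forward of a measure carried by [0, 1] under h : [0, 1] -> R. As
   h : R -> R is arbitrary (possibly non-measurable) off [0, 1], it is
   replaced by 0 there. *)
Definition pushforward01 (mu : probability (measurableTypeR R) R)
    (h : R -> R) : set (measurableTypeR R) -> \bar R :=
  pushforward mu
    (h \_ `[0, 1] : measurableTypeR R -> measurableTypeR R).

End Fourier.

(* Main.v *)
(* Write beta = 1 / lambda. Since beta is Pisot, the distance of beta ^ k to the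
   nearest integer decays geometrically, so that (as Erdos observed) the Fourier
   transform of mu stays bounded below along the powers of beta.

   The points lambda ^ k (1 - lambda) of X tend to 0, and h' = eta there,
   so Rolle's theorem kills the derivatives of order 2, ..., r of h at 0:
   h x = h 0 + eta x + O(x ^ s). Hence on the cylinder [0, lambda ^ n], of mass
   2 ^ -n, h is affine up to O(lambda ^ (n s)). Take a frequency of order
   beta ^ (n s) which is a power of beta up to the factor eta. Multiplying by a
   product of squared cosines localized at h 0 isolates this cylinder; this only
   averages the Fourier transform of the push-forward over frequencies at
   distance O(beta ^ n), which is negligible as s > 1. On the cylinder the
   localizer varies slowly while the phases are nearly constant modulo 1, so the
   localized integral is at least of order 2 ^ -n. Comparing with the decay
   beta ^ (- n s tau) and letting n grow gives the bound on tau. *)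

Require Import Defs.
From mathcomp Require Import ring lra zify separable measurable_realfun.
Import Order.TTheory GRing.Theory Num.Theory.
Import numFieldNormedType.Exports.
Local Open Scope classical_set_scope.
Local Open Scope ring_scope.

Set Implicit Arguments.
Unset Strict Implicit.
Unset Printing Implicit Defensive.

(** * Powers of a Pisot number are nearly integers *)

(** The localizer pulls in two directions. A large damping [M] suppresses the mass outside
    [0, lambda ^ n], but the product is then known to be large only on the smaller cylinder
    [0, lambda ^ (n + m)], so the main term is of order p 2 ^ -m 2 ^ -n, with p the lower bound
    along the powers of beta. Taking M = L m with [L] fixed resolves this: relative to 2 ^ -n the
    outside contributes O(4 ^ -m), which beats 2 ^ -m, while M 4 ^ -m still becomes small, which
    keeps the product above 1 / 2 on the smaller cylinder. Nonnegativity of the squared cosines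
    allows the rest of the cylinder to be dropped from its average.

    The first powers of beta need not be close to integers. Hence phases are peeled off only from
    beta ^ k0 on, where the errors form a small geometric tail, and the factor left over is the
    transform at the fixed frequency beta ^ k0. All of [m], [M], [k0], [k2] and a minimal [Q] are
    fixed before [n]; the integer part of n s is then written as n + Q + k0 + k2. *)

(* Reducing P' X^k modulo P, the coefficient of degree deg P - 1 is the k-th
   power sum of the roots, with multiplicities. *)
Lemma power_sum_decomposition (K : comNzRingType) (r : seq K) (k : nat) :
  let P := \prod_(z <- r) ('X - z%:P) in
  exists u T : {poly K}, [/\ P^`() * 'X^k = u * P + T, (size T <= size r)%N
    & (T * 'X)`_(size r) = \sum_(z <- r) z ^+ k].
Proof.
elim: r => [|z r [u [T [eqT szT cT]]]] /=.
  exists 0, 0; rewrite !big_nil size_poly0 coefMX -[1]/(1%:P) derivC.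
  by split=> //; rewrite !mul0r addr0.
rewrite !big_cons; set P := \prod_(_ <- r) _ in eqT *.
have mP : P \is monic by apply: monic_prod_XsubC.
have szP : size P = (size r).+1 by rewrite /P size_prod_XsubC.
have [v Ev] : exists v, 'X^k = v * ('X - z%:P) + (z ^+ k)%:P.
  have /factor_theorem [v Ev] : root ('X^k - (z ^+ k)%:P) z.
    by rewrite /root !hornerE subrr.
  by exists v; rewrite -Ev subrK.
(* (X - z) P has derivative P + (X - z) P'. Modulo (X - z) P the product P X ^ k reduces to z ^ k P,
   which adds z ^ k to the coefficient; the shift [T * 'X] avoids a predecessor for empty [r]. *)
exists (v + u), ((z ^+ k)%:P * P + T * ('X - z%:P)); split.
- rewrite derivM derivXsubC mul1r mulrDl {1}Ev -mulrA eqT; ring.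
- rewrite (leq_trans (size_polyD _ _)) // geq_max; apply/andP; split.
    by rewrite (leq_trans (size_polyMleq _ _))// szP size_polyC; case: eqP.
  by rewrite (leq_trans (size_polyMleq _ _))// size_XsubC addn2.
- rewrite coefMX /= coefD coefCM mulrBr coefB coefMC.
  have -> : P`_(size r) = 1.
    by have := monicP mP; rewrite lead_coefE szP.
  by rewrite (nth_default 0 szT) mul0r subr0 mulr1 cT.
Qed.

(** Division by a monic polynomial keeps integer coefficients, and uniqueness of the remainder
    identifies its image in [K] with [T]. *)
Lemma power_sum_int (K : comNzRingType) (m : {poly int}) (r : seq K) (k : nat) :
  m \is monic -> map_poly intr m = \prod_(z <- r) ('X - z%:P) ->
  exists n : int, \sum_(z <- r) z ^+ k = n%:~R.
Proof.
move=> mm Em.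
have [u [T [ET szT <-]]] := power_sum_decomposition r k.
pose q := Pdiv.Ring.rmodp (m^`() * 'X^k) m.
exists (q * 'X)`_(size r).
rewrite -coef_map rmorphM /= map_polyX; congr ((_ * _ : {poly K})`_ _).
have mP : \prod_(z <- r) ('X - z%:P) \is monic by apply: monic_prod_XsubC.
have szP : size (\prod_(z <- r) ('X - z%:P)) = (size r).+1.
  by rewrite size_prod_XsubC.
have := Pdiv.RingMonic.rmodp_addl_mul_small mP u (r := T).
rewrite szP ltnS szT -ET -Em => /(_ isT) <-.
have Eq : m^`() * 'X^k = Pdiv.Ring.rdivp (m^`() * 'X^k) m * m + q.
  exact: Pdiv.RingMonic.rdivp_eq.
have -> : (map_poly intr m)^`() * 'X^k =
    map_poly intr (Pdiv.Ring.rdivp (m^`() * 'X^k) m) * map_poly intr m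
    + map_poly intr q :> {poly K}.
  by rewrite -rmorphM -rmorphD /= -Eq rmorphM /= deriv_map map_polyXn.
rewrite Pdiv.RingMonic.rmodp_addl_mul_small //; first by rewrite Em.
rewrite Em szP (leq_ltn_trans (size_poly _ _)) //.
have szm : size m = (size r).+1.
  have : size (map_poly intr m : {poly K}) = size m.
    by apply: size_map_poly_id0; rewrite (monicP mm) oner_neq0.
  by rewrite Em szP.
by rewrite -szm Pdiv.Ring.ltn_rmodpN0 // monic_neq0.
Qed.

Lemma ex_irreducible_root (K : fieldType) (L : fieldType)
    (iota : {rmorphism K -> L}) (p : {poly K}) (x : L) :
  p != 0 -> root (map_poly iota p) x ->
  exists m : {poly K}, [/\ irreducible_poly m, m %| p
    & root (map_poly iota m) x].
Proof.
move: {2}(size p) (leqnn (size p)) => n; elim: n p => [|n IHn] p szp p0 px.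
  by move: szp; rewrite leqn0 size_poly_eq0 (negPf p0).
have sp1 : (1 < size p)%N.
  rewrite ltnNge; apply/negP => /size1_polyC Ep; move: px p0.
  by rewrite Ep map_polyC rootC fmorph_eq0 polyC_eq0 => ->.
have [[d [d1 dp ndp]]|irr] := pselect (exists d : {poly K},
    [/\ size d != 1%N, d %| p & ~~ (d %= p)]); last first.
  exists p; split=> //; split=> // d d1 dp; apply: contrapT => /negP ndp.
  by apply: irr; exists d.
have d0 : d != 0 by apply: dvdpN0 dp p0.
have szd : (size d < size p)%N.
  by rewrite ltn_neqAle dvdp_leq // andbT; apply: contra ndp; rewrite dvdp_size_eqp.
have [q Eq] := dvdpP _ _ dp.
have q0 : q != 0 by apply: contraNneq p0 => q0; rewrite Eq q0 mul0r.
have szq : (size q < size p)%N.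
  rewrite Eq size_mul //.
  have d_gt0 : (0 < size d)%N by rewrite size_poly_gt0.
  by case: (size d) d_gt0 d1 => [|[|k]] // _ _; rewrite !addnS /= ltnS leq_addr.
move: px; rewrite Eq rmorphM rootM => /orP[qx|dx].
  have [m [mi mq mx]] := IHn q (leq_trans szq szp) q0 qx.
  by exists m; split=> //; apply: dvdp_mulr.
have [m [mi md mx]] := IHn d (leq_trans szd szp) d0 dx.
by exists m; split=> //; apply: dvdp_mull.
Qed.

(** The power sum over all conjugates is an integer, and it differs from [x ^+ k] by the power sum
    of the other conjugates, all of modulus at most [rho]; [D] is their number. *)
Lemma pisot_near_integer (R : rcfType) (x : R) : pisot x ->
  exists D rho : R, [/\ 0 <= D, 0 < rho, rho < 1 &
    forall k : nat, exists n : int, `|x ^+ k - n%:~R| <= D * rho ^+ k].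
Proof.
case=> x1 [p [pm px]] conj.
have [m [mi mp mx]] : exists m : {poly rat}, [/\ irreducible_poly m,
    m %| map_poly intr p & root (map_poly ratr m) x].
  apply: ex_irreducible_root; first by rewrite map_poly_eq0_id0 ?monic_neq0 //
    (monicP pm) oner_neq0.
  rewrite -map_poly_comp (eq_map_poly (g := intr)) // => i /=.
  exact: ratr_int.
have [p1 [a a0 Em] [q Eq]] := dvdpP_rat_int mp.
(* [p1] divides the monic [p] over the integers, so its leading coefficient is 1 or -1. *)
wlog p1m : p1 a a0 q Em Eq / p1 \is monic.
  move=> H; have : lead_coef p1 \is a GRing.unit.
    apply/unitrPr; exists (lead_coef q); rewrite -lead_coefM -Eq.
    exact/monicP.
  rewrite qualifE /= /ssrint.intUnitRing.unitz => /orP [l1|l1].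
    by apply: (H p1 a a0 q).
  apply: (H (- p1) (- a) _ (- q)); rewrite ?oppr_eq0 ?mulrNN //.
    by rewrite rmorphN /= scaleNr scalerN opprK.
  by rewrite monicE lead_coefN (eqP l1).
have p1i : irreducible_poly (map_poly intr p1 : {poly rat}).
  by apply/irreducible_rat_int/irreducible_rat_int; move: mi; rewrite Em;
    case=> s1 H; split; [move: s1; rewrite size_scale
    |move=> d d1 dp; rewrite (eqp_trans (H d d1 _)) ?dvdpZr // eqp_scale].
have p1x : root (map_poly intr p1) x.
  move: mx; rewrite Em map_polyZ rootZ ?fmorph_eq0 // -map_poly_comp.
  by rewrite (eq_map_poly (g := intr)) // => i /=; apply: ratr_int.
pose P := map_poly intr p1 : {poly R[i]}.
have P1 : lead_coef P = 1.
  rewrite /P lead_coef_map_eq ?(monicP p1m) ?oner_neq0 //.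
have [r Er] := closed_field_poly_normal P.
rewrite P1 scale1r in Er.
have EP : P = map_poly ratr (map_poly intr p1 : {poly rat}).
  rewrite -map_poly_comp; apply: eq_map_poly => i /=.
  by rewrite ratr_int.
(* Roots are simple, so removing [x] once from [r] leaves only roots different from [x], those that
   the Pisot condition controls. *)
have ur : uniq r.
  rewrite -separable_prod_XsubC -Er EP separable_map.
  rewrite unlock; apply/coprimepP => d dp dp'.
  case: p1i => s1 H; have [//|d1] := boolP (size d == 1%N).
    by rewrite -size_poly_eq1.
  have := H d d1 dp; rewrite /eqp => /andP[_ pd].
  have := dvdp_trans pd dp'; rewrite gtNdvdp //.
    apply/eqP => /(congr1 (fun q0 : {poly rat} =>
      q0`_(size (map_poly intr p1 : {poly rat})).-2)).
    rewrite coef0 coef_deriv -[_.-2.+1]prednK ?prednK ?ltn_predRL // => /eqP.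
    rewrite -mulr_natr mulf_eq0 pnatr_eq0 -lead_coefE lead_coef_eq0.
    rewrite (negPf (irredp_neq0 _)) //=.
    by move: s1; case: (size _) => [|[|]].
  by rewrite lt_size_deriv // irredp_neq0.
have xr : (x%:C)%C \in r.
  rewrite -root_prod_XsubC -Er.
  have -> : P = map_poly (real_complex R) (map_poly intr p1).
    rewrite -map_poly_comp; apply: eq_map_poly => i /=.
    by rewrite rmorph_int.
  by rewrite fmorph_root.
(* The default 1 / 2 keeps [rho] positive and below 1 when there is no other conjugate. *)
pose rho : R := \big[Num.max/2^-1]_(z <- rem (x%:C)%C r) ComplexField.Normc.normc z.
have zr z : z \in rem (x%:C)%C r -> ComplexField.Normc.normc z < 1.
  rewrite mem_rem_uniq // inE => /andP[zx zr].
  have : `|z| < 1.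
    apply: conj zx; exists (map_poly intr p1); split=> //.
      by rewrite -map_poly_comp (eq_map_poly (g := intr)) // => i /=; apply: ratr_int.
    by rewrite -EP Er root_prod_XsubC.
  by rewrite normc_def -[1]/(1%:C)%C ltcR; case: z zr zx.
have rho0 : 0 < rho by apply: lt_le_trans (bigmax_ge_id _ _ _ _); rewrite invr_gt0.
exists (size (rem (x%:C)%C r))%:R, rho; split=> //.
  rewrite /rho big_seq; apply: bigmax_lt => //; rewrite ?invf_lt1 ?ltr1n //.
move=> k; have [n En] := power_sum_int k p1m Er.
exists n; move: En; rewrite (big_rem _ xr) /= => En.
rewrite -lecR; have -> : (`|x ^+ k - n%:~R|%:C)%C = `|((x ^+ k - n%:~R)%:C)%C|.
  by rewrite normc_def /= expr0n addr0 sqrtr_sqr.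
rewrite rmorphB rmorphXn rmorph_int -En opprD addNKr normrN.
rewrite (le_trans (ler_norm_sum _ _ _)) //.
rewrite rmorphM rmorph_nat rmorphXn /= mulr_natl.
rewrite -(count_predT (rem _ r)) -iter_addr_0 -big_const_seq big_seq [leRHS]big_seq.
apply: ler_sum => z zr'; rewrite normrX lerXn2r // ?nnegrE ?ler0c ?(ltW rho0) //.
have -> : `|z| = (ComplexField.Normc.normc z)%:C%C by rewrite normc_def; case: z zr'.
by rewrite lecR /rho; apply: bigmax_sup_seq zr' _ _.
Qed.

(** For x = 1 / lambda the difference is (1 - lambda) lambda ^ -(k + 1), the offset of [e1] times a
    frequency: the phase shift produced by one use of self-similarity. *)
Lemma pisot_diff_near_integer (R : rcfType) (x : R) : pisot x ->
  exists D rho : R, [/\ 0 <= D, 0 < rho, rho < 1 &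
    forall k : nat, exists n : int, `|x ^+ k.+1 - x ^+ k - n%:~R| <= D * rho ^+ k].
Proof.
move=> /pisot_near_integer [D [rho [D0 rho0 rho1 near]]].
exists (D + D), rho; split=> // [|k]; first by rewrite addr_ge0.
have [n0 near0] := near k; have [n1 near1] := near k.+1; exists (n1 - n0).
have -> : x ^+ k.+1 - x ^+ k - (n1 - n0)%:~R =
    (x ^+ k.+1 - n1%:~R) - (x ^+ k - n0%:~R) by rewrite rmorphB /=; ring.
rewrite mulrDl (le_trans (ler_normB _ _)) // lerD // (le_trans near1) //.
by rewrite ler_wpM2l // exprS ler_piMl ?exprn_ge0 // ltW.
Qed.

(** * Trigonometric estimates *)

Section trigonometry.
Variable R : realType.
Implicit Types (x y : R) (n : int).

Lemma cos_lipschitz x y : `|cos x - cos y| <= `|x - y|.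
Proof.
wlog xy : x y / y <= x => [H|].
  by have [/H//|/ltW/H] := leP y x; rewrite distrC (distrC x).
have [c _ ->] := @MVT_segment R cos (fun z => - sin z) y x xy
  (fun z _ => is_derive_cos z) (continuous_subspaceT (@continuous_cos R)).
by rewrite normrM normrN ler_piMl // sin_max.
Qed.

Lemma sin_norm_le x : `|sin x| <= `|x|.
Proof.
have := cos_lipschitz (x - pi / 2) (- (pi / 2)).
by rewrite cosBpihalf cosN cos_pihalf subr0 opprK subrK.
Qed.

Lemma cosD_2pi_int x n : cos (x + 2 * pi * n%:~R) = cos x.
Proof.
have nat_case (z : R) (k : nat) : cos (z + 2 * pi * k%:R) = cos z.
  have -> : 2 * pi * k%:R = pi *+ 2 *+ k :> R.
    by rewrite -mulr_natr -[pi *+ 2]mulr_natr; ring.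
  exact: (periodicn (@cosD2pi R)).
case: (intP n) => [|k|k]; first by rewrite mulr0 addr0.
  exact: nat_case.
rewrite mulrNz mulrN -[in RHS](subrK (2 * pi * k.+1%:R) x).
by rewrite nat_case.
Qed.

Lemma norm_cosD_pi_int x n : `|cos (x + pi * n%:~R)| = `|cos x|.
Proof.
have nat_case (z : R) (k : nat) : `|cos (z + pi * k%:R)| = `|cos z|.
  elim: k => [|k IHk]; first by rewrite mulr0 addr0.
  by rewrite -natr1 mulrDr mulr1 addrA cosDpi normrN.
case: (intP n) => [|k|k]; first by rewrite mulr0 addr0.
  exact: nat_case.
rewrite mulrNz mulrN -[in RHS](subrK (pi * k.+1%:R) x).
by rewrite nat_case.
Qed.

Lemma norm_cos_pi_ge x n : 1 - (pi * (x - n%:~R)) ^+ 2 <= `|cos (pi * x)|.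
Proof.
rewrite -[x in leRHS](subrK n%:~R) [in leRHS]mulrDr norm_cosD_pi_int.
set u := pi * _; have c1 := cos_max u.
rewrite (@le_trans _ _ (`|cos u| ^+ 2)) //; last by rewrite expr2 ler_piMl.
rewrite real_normK ?num_real // cos2sin2 lerB // -[leLHS]real_normK ?num_real //.
by rewrite -[leRHS]real_normK ?num_real // lerXn2r ?nnegrE // sin_norm_le.
Qed.

Lemma cos_pi_eq0 x : cos (pi * x) = 0 -> exists n, x = n%:~R + 2^-1.
Proof.
move=> x0; exists (Num.floor x).
have /andP[fx xf] := floor_itv x.
have : `|cos (pi * (x - (Num.floor x)%:~R))| = 0.
  by rewrite -(norm_cosD_pi_int _ (Num.floor x)) -mulrDr subrK x0 normr0.
move=> /normr0P/eqP f0.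
have pi0 := pi_gt0 R.
have : pi * (x - (Num.floor x)%:~R) = pi / 2.
  apply: cos_inj; rewrite ?cos_pihalf // in_itv /=.
    rewrite mulr_ge0 ?subr_ge0 ?(ltW pi0) //= ler_piMr ?(ltW pi0) //.
    by move: xf; rewrite intrD; lra.
  by apply/andP; split; lra.
by move=> /(mulfI (lt0r_neq0 pi0)) /eqP; rewrite subr_eq addrC => /eqP.
Qed.

End trigonometry.

(** After subtraction of [n], a monic relation of degree d for 1 / 2, multiplied by 2 ^ d, would
    make an odd integer vanish. *)
Lemma half_integer_not_integral (R : realFieldType) (n : int) :
  ~ integralOver intr (n%:~R + 2^-1 : R).
Proof.
move=> H; have {H} : integralOver intr (2^-1 : R).
  have -> : 2^-1 = (n%:~R + 2^-1) - n%:~R :> R by rewrite addrAC subrr add0r.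
  by apply: integral_sub => //; apply: integral_id.
case=> p pm; rewrite /root horner_coef.
set q := map_poly intr p; have q1 : lead_coef q = 1.
  by rewrite lead_coef_map_eq ?(monicP pm) ?oner_neq0.
have : q != 0 by rewrite -lead_coef_eq0 q1 oner_neq0.
rewrite -size_poly_gt0; case E : (size q) => [//|d] _.
rewrite big_ord_recr /=.
have -> : q`_d = 1 by rewrite -q1 lead_coefE E.
rewrite mul1r.
have [m Em] : exists m : int,
    (\sum_(i < d) q`_i * 2^-1 ^+ i) * 2 ^+ d = 2 * m%:~R.
  exists (\sum_(i < d) p`_i * 2 ^+ (d - i.+1)).
  rewrite rmorph_sum /= mulr_suml mulr_sumr; apply: eq_bigr => i _.
  rewrite rmorphM rmorphXn /= coef_map -mulrA exprVn.
  have -> : 2 ^+ d = 2 ^+ i * (2 * 2 ^+ (d - i.+1)) :> R.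
    by rewrite -exprS -exprD -addSnnS subnKC.
  rewrite mulKf ?expf_neq0 ?pnatr_eq0 //=; ring.
move/eqP/(congr1 (fun z => z * 2 ^+ d)).
rewrite mul0r mulrDl Em exprVn mulVf ?expf_neq0 ?pnatr_eq0 // => /eqP.
have -> : 2 * m%:~R + 1 = (2 * m + 1)%:~R :> R by rewrite rmorphD rmorphM.
rewrite intr_eq0 => /eqP; lia.
Qed.

(** Near-integrality says nothing for small [k]; a zero there is excluded because a half-integer
    would be an algebraic integer. *)
Lemma pisot_cos_neq0 (R : realType) (x : R) (k : nat) : pisot x ->
  cos (pi * (x ^+ k.+1 - x ^+ k)) != 0.
Proof.
case=> _ [p [pm px]] _; apply/eqP => /cos_pi_eq0 [n En].
apply: (@half_integer_not_integral R n); rewrite -En.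
have ix : integralOver intr x by exists p.
have iX j : integralOver intr (x ^+ j).
  elim: j => [|j IHj]; first exact: integral1.
  by rewrite exprS; apply: integral_mul.
exact: integral_sub.
Qed.

(** * Averages against the Bernoulli convolution *)

Lemma exp_eventually_lt (R : realType) (x e : R) : 0 <= x -> x < 1 -> 0 < e ->
  exists N, forall n, (N <= n)%N -> x ^+ n < e.
Proof.
move=> x0 x1 e0; have /cvgrPdist_lt/(_ e e0) [N _ HN] : GRing.exp x @ \oo --> (0 : R).
  by apply: cvg_expr; rewrite ger0_norm.
exists N => n Nn; have := HN n Nn.
by rewrite sub0r normrN ger0_norm // exprn_ge0.
Qed.

Section bounded_measurable.
Variable R : realType.
Implicit Types f g : R -> R.

Definition bounded_measurable f : Prop :=
  measurable_fun [set: measurableTypeR R] f /\ exists B : R, forall x, `|f x| <= B.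

Lemma bounded_measurable_cst (c : R) : bounded_measurable (fun=> c).
Proof. by split; [exact: measurable_cst|exists `|c|]. Qed.

Lemma bounded_measurableD f g : bounded_measurable f -> bounded_measurable g ->
  bounded_measurable (fun x => f x + g x).
Proof.
move=> [mf [A fA]] [mg [B gB]]; split; first exact: measurable_funD.
by exists (A + B) => x; rewrite (le_trans (ler_normD _ _)) // lerD.
Qed.

Lemma bounded_measurableM f g : bounded_measurable f -> bounded_measurable g ->
  bounded_measurable (fun x => f x * g x).
Proof.
move=> [mf [A fA]] [mg [B gB]]; split; first exact: measurable_funM.
by exists (A * B) => x; rewrite normrM ler_pM.
Qed.

Lemma bounded_measurableZ (c : R) f : bounded_measurable f ->
  bounded_measurable (fun x => c * f x).
Proof. exact/bounded_measurableM/bounded_measurable_cst. Qed.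

Lemma bounded_measurableB f g : bounded_measurable f -> bounded_measurable g ->
  bounded_measurable (fun x => f x - g x).
Proof.
move=> bf bg; have := bounded_measurableD bf (bounded_measurableZ (-1) bg).
by under eq_fun do rewrite mulN1r.
Qed.

Lemma bounded_measurable_cos f : measurable_fun [set: measurableTypeR R] f ->
  bounded_measurable (fun x => cos (f x)).
Proof.
move=> mf; split; last by exists 1 => x; exact: cos_max.
apply: (measurableT_comp _ mf).
by apply: continuous_measurable_fun; exact: continuous_cos.
Qed.

Lemma bounded_measurable_comp f (phi : R -> R) :
  measurable_fun [set: measurableTypeR R] phi -> bounded_measurable f ->
  bounded_measurable (fun x => f (phi x)).
Proof.
by move=> mphi [mf [A fA]]; split; [exact: (measurableT_comp mf)|exists A].
Qed.

End bounded_measurable.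

Section bernoulli.
Variables (R : realType) (lambda : R).
Variable mu : probability (measurableTypeR R) R.
Hypotheses (lambda_gt0 : 0 < lambda) (lambda_lt1 : lambda < 1).
Hypothesis mu_bernoulli : is_bernoulli_convolution lambda mu.
Implicit Types f g : R -> R.

Definition mean f : R := \int[mu]_x f x.

Lemma bounded_measurable_integrable f : bounded_measurable f ->
  mu.-integrable [set: measurableTypeR R] (EFin \o f).
Proof.
move=> [mf [B fB]]; apply: measurable_bounded_integrable => //.
- exact: le_lt_trans (probability_le1 mu measurableT) (ltry 1).
- exists B; split; first by rewrite num_real.
  by move=> M BM x _; exact: le_trans (fB x) (ltW BM).
Qed.
Let bmi := bounded_measurable_integrable.

Lemma meanD f g : bounded_measurable f -> bounded_measurable g ->
  mean (fun x => f x + g x) = mean f + mean g.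
Proof. by move=> bf bg; apply: RintegralD => //; apply: bmi. Qed.

Lemma meanB f g : bounded_measurable f -> bounded_measurable g ->
  mean (fun x => f x - g x) = mean f - mean g.
Proof. by move=> bf bg; apply: RintegralB => //; apply: bmi. Qed.

Lemma meanZ c f : bounded_measurable f -> mean (fun x => c * f x) = c * mean f.
Proof. by move=> bf; apply: RintegralZl => //; apply: bmi. Qed.

Lemma mean_cst c : mean (fun=> c) = c.
Proof.
rewrite /mean Rintegral_cst // -[RHS]mulr1; congr (_ * _).
by rewrite -[RHS]/(fine 1%E); congr fine; exact: probability_setT.
Qed.

Lemma measurable_e0 : measurable_fun [set: measurableTypeR R] (e0 lambda).
Proof. exact: mulrl_measurable. Qed.

Lemma measurable_e1 : measurable_fun [set: measurableTypeR R] (e1 lambda).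
Proof.
by apply: measurable_funB => //; apply: measurable_funD.
Qed.

(** Self-similarity alone confines the mass: the preimages of [W t] under [e0] and [e1] lie in
    [W (t / lambda)], so the mass of [W t] is at most that of [W (t / lambda ^ n)], which tends to
    0. *)
Lemma bernoulli_outside0 : mu (~` `[0, 1]%classic) = 0%E.
Proof.
pose W (t : R) : set (measurableTypeR R) := ~` `[- t, 1 + t]%classic.
have mW t : measurable (W t) by apply: measurableC; exact: measurable_itv.
have Wle (t u : R) : t <= u -> W u `<=` W t.
  move=> tu x; rewrite /W /= !in_itv /= => xu xt; apply: xu.
  by move/andP: xt => [? ?]; apply/andP; split; lra.
have step (t : R) : (0 <= t)%R -> (mu (W t) <= mu (W (t / lambda)%R))%E.
  move=> t0; have tl : t / lambda * lambda = t by rewrite divfK // gt_eqF.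
  have key (x : R) : - (t / lambda) <= x <= 1 + t / lambda ->
      - t <= lambda * x <= t + lambda.
    move=> /andP[x1 x2].
    have := x1; rewrite -(ler_pM2l lambda_gt0) mulrN (mulrC lambda) tl => ->.
    have := x2; rewrite -(ler_pM2l lambda_gt0) mulrDr mulr1 addrC.
    by rewrite [lambda * (_ / _)]mulrC tl.
  have half B : measurable B -> B `<=` W (t / lambda)%R ->
      ((2^-1)%:E * mu B <= (2^-1)%:E * mu (W (t / lambda)%R))%E.
    move=> mB BW; apply: lee_wpmul2l; first by rewrite lee_fin invr_ge0.
    by apply: le_measure => //; rewrite inE.
  have half2 (x : \bar R) : x \is a fin_num ->
      x = ((2^-1)%:E * x + (2^-1)%:E * x)%E.
    by move/fineK => <-; rewrite -!EFinM -EFinD; congr EFin; lra.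
  rewrite (mu_bernoulli (mW t)) [leRHS]half2 ?fin_num_measure //.
  apply: leeD; apply: half.
  - by rewrite -[X in measurable X]setTI; apply: measurable_e0.
  - move=> x; rewrite /W /= !in_itv /e0 /= => xW xt; apply: xW.
    have /andP[y1 y2] := key _ xt.
    by rewrite y1 (le_trans y2) // addrC lerD2r ltW.
  - by rewrite -[X in measurable X]setTI; apply: measurable_e1.
  - move=> x; rewrite /W /= !in_itv /e1 /= => xW xt; apply: xW.
    have /andP[y1 y2] := key _ xt; have l1 : 0 <= 1 - lambda by rewrite subr_ge0 ltW.
    rewrite -addrA (le_trans y1) ?lerDl // (le_trans (lerD y2 (lexx _))) //.
    by suff -> : t + lambda + (1 - lambda) = 1 + t by []; ring.
have steps n (t : R) : (0 <= t)%R -> (mu (W t) <= mu (W (t / lambda ^+ n)%R))%E.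
  elim: n t => [|n IHn] t t0; first by rewrite expr0 divr1.
  apply: le_trans (step _ t0) _; rewrite exprS invfM mulrA.
  by apply: IHn; rewrite divr_ge0 // ltW.
have W0 (t : R) : 0 < t -> mu (W t) = 0%E.
  move=> t0; apply/eqP; rewrite eq_le measure_ge0 andbT.
  have := @nonincreasing_cvg_mu _ _ _ mu (fun n => W n%:R).
  have -> : \bigcap_n W n%:R = set0.
    rewrite -subset0 => x Wx.
    have := Wx (Num.truncn `|x|).+1 I; rewrite /W /= in_itv /=; apply.
    have := truncnS_gt `|x|; rewrite -[_.+1%:R]natr1.
    have := ler_norm x; have := ler_norm (- x); rewrite normrN => *.
    by apply/andP; split; lra.
  rewrite measure0 => cW.
  have {}cW : (mu \o (fun n => W n%:R)) @ \oo --> 0%E.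
    apply: cW => //.
    - by rewrite (le_lt_trans (probability_le1 _ _)) // ltry.
    - by move=> m n mn; apply/subsetPset/Wle; rewrite ler_nat.
  apply: (cvge_ge _ cW); near=> n => /=.
  have [k nk] : exists k, n%:R <= t / lambda ^+ k.
    have t1 : 0 < t / (n%:R + 1) by rewrite divr_gt0 // ltr_wpDl.
    have [k kt] := exp_eventually_lt (ltW lambda_gt0) lambda_lt1 t1.
    exists k; rewrite ler_pdivlMr ?exprn_gt0 //.
    have := kt k (leqnn k); rewrite ltr_pdivlMr ?ltr_wpDl // => /ltW.
    apply: le_trans; rewrite mulrC ler_wpM2l ?exprn_ge0 ?(ltW lambda_gt0) //.
    by rewrite lerDl.
  apply: le_trans (steps k t (ltW t0)) _.
  by apply: le_measure; rewrite ?inE //; apply: Wle.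
apply/negligibleP; first by apply: measurableC; exact: measurable_itv.
suff -> : ~` `[0, 1]%classic = \bigcup_n W (n.+1%:R^-1).
  by apply: negligible_bigcup => k; apply/negligibleP => //; apply: W0; rewrite invr_gt0.
have small (d : R) : 0 < d -> exists n : nat, n.+1%:R^-1 < d.
  move=> d0; exists (Num.truncn d^-1).
  by rewrite invf_plt ?posrE //; exact: truncnS_gt.
have widen (x d : R) : 0 <= d -> 0 <= x <= 1 -> - d <= x <= 1 + d.
  by move=> d0 /andP[? ?]; apply/andP; split; lra.
have outside (x : R) : ~ 0 <= x <= 1 ->
    exists n : nat, ~ - n.+1%:R^-1 <= x <= 1 + n.+1%:R^-1.
  move=> x01; have [d d0 xd] : exists2 d : R, 0 < d & x < - d \/ 1 + d < x.
    have [x0|x0] := ltP x 0; first by exists (- x / 2); [lra|left; lra].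
    have [x1|x1] := ltP 1 x; first by exists ((x - 1) / 2); [lra|right; lra].
    by exfalso; apply: x01; rewrite x0 x1.
  have [n nd] := small d d0; exists n => /andP[x1 x2].
  case: xd => xd; first by have := le_lt_trans x1 xd; rewrite ltrN2 ltNge (ltW nd).
  by have := lt_le_trans xd x2; rewrite ltrD2l ltNge (ltW nd).
apply/seteqP; split=> x; rewrite /W /= !in_itv /=.
  by move=> /outside[n xn]; exists n => //=; rewrite in_itv.
move=> [n _] /=; rewrite in_itv /= => xn x01; apply: xn.
by apply: widen => //; rewrite invr_ge0.
Unshelve. all: by end_near.
Qed.

Lemma ge0_mean_self_similar f : bounded_measurable f -> (forall x, 0 <= f x) ->
  mean f = 2^-1 * mean (fun x => f (e0 lambda x))
         + 2^-1 * mean (fun x => f (e1 lambda x)).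
Proof.
move=> bf f0; have [mf _] := bf.
pose m0 : {measure set (measurableTypeR R) -> \bar R} :=
  measure_function_pushforward__canonical__measure_function_Measure mu measurable_e0.
pose m1 : {measure set (measurableTypeR R) -> \bar R} :=
  measure_function_pushforward__canonical__measure_function_Measure mu measurable_e1.
have h0 : (0 <= 2^-1 :> R) by rewrite invr_ge0.
pose k := NngNum h0.
have mEf : measurable_fun [set: measurableTypeR R] (EFin \o f) by exact/measurable_EFinP.
have f0' : forall x : measurableTypeR R, [set: measurableTypeR R] x -> (0 <= (EFin \o f) x)%E.
  by move=> x _; rewrite lee_fin.
have E : (\int[mu]_x (f x)%:E = (2^-1)%:E * \int[mu]_x (f (e0 lambda x))%:E
   + (2^-1)%:E * \int[mu]_x (f (e1 lambda x))%:E)%E.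
  rewrite (@eq_measure_integral _ _ _ _ (measure_add (mscale k m0) (mscale k m1))); last first.
    move=> A mA _; apply: etrans (mu_bernoulli mA) _.
    exact: esym (measure_addE (mscale k m0) (mscale k m1) A).
  rewrite ge0_integral_measure_add // !ge0_integral_mscale //.
  have f0'' : {in [set: measurableTypeR R], forall x, (0 <= (EFin \o f) x)%E}.
    by move=> x _; rewrite lee_fin.
  congr (_ * _ + _ * _)%E.
    exact: (ge0_integral_pushforward measurable_e0 mu measurableT mEf f0'').
  exact: (ge0_integral_pushforward measurable_e1 mu measurableT mEf f0'').
rewrite /mean /Rintegral E.
have i0 := bmi (bounded_measurable_comp measurable_e0 bf).
have i1 := bmi (bounded_measurable_comp measurable_e1 bf).
have fin0 := integrable_fin_num measurableT i0.
have fin1 := integrable_fin_num measurableT i1.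
by rewrite fineD ?fineM // fin_numM.
Qed.

(** Adding the bound [B] reduces to the nonnegative case, and constants satisfy the identity. *)
Lemma mean_self_similar f : bounded_measurable f ->
  mean f = 2^-1 * mean (fun x => f (e0 lambda x))
         + 2^-1 * mean (fun x => f (e1 lambda x)).
Proof.
move=> bf; have [_ [B fB]] := bf.
have bB := bounded_measurable_cst B.
have fB0 x : 0 <= f x + B.
  by rewrite -lerBlDr sub0r; have := fB x; rewrite ler_norml => /andP[].
have := ge0_mean_self_similar (bounded_measurableD bf bB) fB0.
rewrite meanD // (meanD (bounded_measurable_comp measurable_e0 bf)) //.
rewrite (meanD (bounded_measurable_comp measurable_e1 bf)) // mean_cst.
lra.
Qed.

Lemma le_mean f g : bounded_measurable f -> bounded_measurable g ->
  (forall x, 0 <= x <= 1 -> f x <= g x) -> mean f <= mean g.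
Proof.
move=> bf bg fg.
have m01 : measurable (`[0, 1]%classic : set (measurableTypeR R)) by exact: measurable_itv.
have E h : bounded_measurable h -> mean h = \int[mu]_(x in `[0, 1]) h x.
  move=> bh; rewrite /mean /Rintegral; congr fine.
  rewrite (@negligible_integral _ _ _ mu _ (~` `[0, 1]%classic)) //; last 3 first.
  - exact: measurableC.
  - exact: bmi.
  - exact: bernoulli_outside0.
  by rewrite setDE setCK setTI.
rewrite !E //; apply: le_Rintegral => //.
- by apply: (integrableS measurableT) => //; exact: bmi.
- by apply: (integrableS measurableT) => //; exact: bmi.
Qed.

End bernoulli.

(** * Zooming into cylinders and decorrelation at high frequency *)

Section zooming.
Variables (R : realType) (lambda : R).
Variable mu : probability (measurableTypeR R) R.
Hypotheses (lambda_gt0 : 0 < lambda) (lambda_lt1 : lambda < 1).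
Hypothesis mu_bernoulli : is_bernoulli_convolution lambda mu.
Implicit Types f g : R -> R.
Local Notation mean := (mean mu).
Local Notation le_mean := (le_mean lambda_gt0 lambda_lt1 mu_bernoulli).
Local Notation mean_self_similar := (mean_self_similar mu_bernoulli).

Lemma e0_01 (x : R) : 0 <= x <= 1 -> 0 <= e0 lambda x <= 1.
Proof.
move=> /andP[x0 x1]; rewrite /e0 mulr_ge0 ?(ltW lambda_gt0) //=.
by rewrite mulr_ile1 // ltW.
Qed.

Lemma e1_01 (x : R) : 0 <= x <= 1 -> 1 - lambda <= e1 lambda x <= 1.
Proof.
move=> /andP[x0 x1]; rewrite /e1 -addrA lerDr mulr_ge0 ?(ltW lambda_gt0) //=.
by rewrite -lerBrDr subKr ler_piMr // ltW.
Qed.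

Lemma mean_dist_le f g (d : R) : bounded_measurable f -> bounded_measurable g ->
  (forall x, 0 <= x <= 1 -> `|f x - g x| <= d) -> `|mean f - mean g| <= d.
Proof.
move=> bf bg fgd; have bfg := bounded_measurableB bf bg.
rewrite -meanB // ler_norml -[d](mean_cst mu) -[X in X <= _ <= _](mean_cst mu).
by apply/andP; split; apply: le_mean => //; try exact: bounded_measurable_cst;
  move=> x /fgd; rewrite ler_norml => /andP[] //; rewrite mean_cst.
Qed.

Lemma measurable_scale (c : R) :
  measurable_fun [set: measurableTypeR R] (fun x : R => c * x).
Proof. exact: mulrl_measurable. Qed.

Lemma bounded_measurable_scale f (c : R) : bounded_measurable f ->
  bounded_measurable (fun x => f (c * x)).
Proof. by apply: bounded_measurable_comp; exact: measurable_scale. Qed.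

(** Each use of self-similarity splits off the right half of the current cylinder, at scale lambda ^
    i and of mass 2 ^ -(i + 1); only [0, lambda ^ n] remains. *)
Lemma mean_zoom f (t : nat -> R) n : bounded_measurable f ->
  (forall i y, (i < n)%N -> 0 <= y <= 1 ->
     `|f (lambda ^+ i * e1 lambda y)| <= t i) ->
  `|mean f - 2 ^- n * mean (fun y => f (lambda ^+ n * y))|
    <= \sum_(i < n) 2 ^- i.+1 * t i.
Proof.
move=> bf; elim: n => [|n IHn] ft.
  rewrite big_ord0 expr0 invr1 mul1r.
  have -> : (fun y => f (1 * y)) = f by apply/funext => y; rewrite mul1r.
  by rewrite subrr normr0.
rewrite big_ord_recr /=.
have -> : mean f - 2 ^- n.+1 * mean (fun y => f (lambda ^+ n.+1 * y)) =
  (mean f - 2 ^- n * mean (fun y => f (lambda ^+ n * y))) +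
  2 ^- n.+1 * mean (fun y => f (lambda ^+ n * e1 lambda y)).
  rewrite [mean (fun y => f (lambda ^+ n * y))]mean_self_similar; last first.
    exact: bounded_measurable_scale.
  have -> : (fun y => f (lambda ^+ n.+1 * y)) = (fun y => f (lambda ^+ n * e0 lambda y)).
    by apply/funext => y; rewrite exprSr -mulrA.
  rewrite exprS invfM; ring.
apply: le_trans (ler_normD _ _) _; apply: lerD.
  by apply: IHn => i y ilt; apply: ft; exact: leqW.
rewrite normrM gtr0_norm ?invr_gt0 ?exprn_gt0 // ler_wpM2l ?invr_ge0 ?exprn_ge0 //.
rewrite -[mean _]subr0 -[X in _ - X](mean_cst mu 0); apply: mean_dist_le.
- apply: bounded_measurable_comp (bounded_measurable_scale _ bf).
  exact: measurable_e1.
- exact: bounded_measurable_cst.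
- by move=> x x01; rewrite subr0; exact: ft.
Qed.

Lemma mean_zoom_ge f m (a : R) : bounded_measurable f ->
  (forall x, 0 <= x <= 1 -> 0 <= f x) ->
  (forall x, 0 <= x <= 1 -> a <= f (lambda ^+ m * x)) ->
  2 ^- m * a <= mean f.
Proof.
move=> bf f0; elim: m => [|m IHm] in f bf f0 *.
  rewrite expr0 invr1 mul1r => fa; rewrite -[a](mean_cst mu).
  by apply: le_mean => //; [exact: bounded_measurable_cst|move=> x /fa; rewrite mul1r].
move=> fa; rewrite (mean_self_similar bf).
have b0 : bounded_measurable (fun x => f (e0 lambda x)) by exact: bounded_measurable_scale.
have b1 : bounded_measurable (fun x => f (e1 lambda x)).
  exact: bounded_measurable_comp (measurable_e1 lambda) bf.
rewrite -[leLHS]addr0; apply: lerD.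
  rewrite exprS invfM -mulrA ler_wpM2l ?invr_ge0 //; apply: IHm => //.
    by move=> x /e0_01; exact: f0.
  by move=> x /fa; rewrite /e0 mulrA -exprS.
rewrite mulr_ge0 ?invr_ge0 // -(mean_cst mu 0); apply: le_mean => //.
  exact: bounded_measurable_cst.
move=> x /e1_01 /andP[x0 x1]; apply: f0; rewrite x1 andbT.
by rewrite (le_trans _ x0) // subr_ge0 ltW.
Qed.

(* Each application of self-similarity shifts the phase by
   2 pi (1 - lambda) lambda ^- k, which is almost a multiple of 2 pi. *)
Lemma mean_correlation (k0 : nat) (d : nat -> R) (phi delta : R)
    (dist_int : forall k, exists n : int,
       `|(1 - lambda) * lambda ^- k.+1 - n%:~R| <= d k)
    (q : nat) (Psi : R -> R) : bounded_measurable Psi ->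
  (forall x, 0 <= x <= 1 -> 0 <= Psi x <= 1) ->
  (forall x y, 0 <= x <= 1 -> 0 <= y <= 1 -> `|x - y| <= lambda ^+ q ->
     `|Psi x - Psi y| <= delta) ->
  `|mean (fun y => Psi y * cos (2 * pi * lambda ^- (q + k0) * y - phi))
    - mean Psi * mean (fun z => cos (2 * pi * lambda ^- k0 * z - phi))|
  <= delta + \sum_(j < q) 2 * pi * d (k0 + j)%N.
Proof.
have bcos (a b : R) : bounded_measurable (fun y => cos (a * y - b)).
  by apply: bounded_measurable_cos; apply: measurable_funB.
elim: q Psi => [|q IHq] Psi bPsi Psi01 osc.
  (* At depth 0 the oscillation hypothesis covers all of [0, 1], so [Psi] is within [delta] of its
     mean. *)
  rewrite big_ord0 addr0 add0n -meanZ //; apply: mean_dist_le.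
  - exact: bounded_measurableM.
  - exact: bounded_measurableZ.
  - move=> x x01; rewrite -mulrBl normrM.
    rewrite (@le_trans _ _ `|Psi x - mean Psi|) ?ler_piMr ?cos_max //.
    rewrite -[Psi x](mean_cst mu); apply: mean_dist_le => //.
      exact: bounded_measurable_cst.
    move=> y y01; apply: osc => //; rewrite expr0 ler_norml.
    by move: x01 y01 => /andP[? ?] /andP[? ?]; apply/andP; split; lra.
have l0 : lambda != 0 by rewrite gt_eqF.
have lq := exprn_gt0 q lambda_gt0.
pose f0 y := Psi (e0 lambda y) * cos (2 * pi * lambda ^- (q + k0) * y - phi).
pose f1 y := Psi (e1 lambda y) * cos (2 * pi * lambda ^- (q + k0) * y - phi).
have bP0 : bounded_measurable (fun x => Psi (e0 lambda x)) by exact: bounded_measurable_scale.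
have bP1 : bounded_measurable (fun x => Psi (e1 lambda x)).
  exact: bounded_measurable_comp (measurable_e1 lambda) bPsi.
have bf0 : bounded_measurable f0 by exact: bounded_measurableM.
have bf1 : bounded_measurable f1 by exact: bounded_measurableM.
have e1_01' x : 0 <= x <= 1 -> 0 <= e1 lambda x <= 1.
  move=> /e1_01 /andP[x0 ->]; rewrite andbT (le_trans _ x0) //.
  by rewrite subr_ge0 ltW.
have scale_dist (x y : R) : `|x - y| <= lambda ^+ q ->
    `|lambda * x - lambda * y| <= lambda ^+ q.+1.
  by move=> xy; rewrite -mulrBr normrM gtr0_norm // exprS ler_pM2l.
(* Composition with [e0] or [e1] turns scale lambda ^ (q + 1) into lambda ^ q, so both halves meet
   the induction hypothesis with the same [delta]. *)
have I0 := IHq _ bP0 (fun x x01 => Psi01 _ (e0_01 x01))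
  (fun x y x01 y01 xy => osc _ _ (e0_01 x01) (e0_01 y01) (scale_dist _ _ xy)).
have osc1 x y : 0 <= x <= 1 -> 0 <= y <= 1 -> `|x - y| <= lambda ^+ q ->
    `|Psi (e1 lambda x) - Psi (e1 lambda y)| <= delta.
  move=> x01 y01 xy; apply: osc; try exact: e1_01'.
  have -> : e1 lambda x - e1 lambda y = lambda * x - lambda * y by rewrite /e1; ring.
  exact: scale_dist.
have I1 := IHq _ bP1 (fun x x01 => Psi01 _ (e1_01' x x01)) osc1.
set S := \sum_(j < q) _ in I0 I1.
set mc := mean (fun z => cos _) in I0 I1 *.
rewrite big_ord_recr /= -/S.
pose F y := Psi y * cos (2 * pi * lambda ^- (q.+1 + k0) * y - phi).
have bF : bounded_measurable F by exact: bounded_measurableM.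
have E0 : mean (fun y => F (e0 lambda y)) = mean f0.
  congr mean; apply/funext => y; rewrite /F /f0 /e0; congr (_ * cos (_ - _)).
  by rewrite addSn exprSr; field; rewrite l0 expf_neq0.
have E1 : `|mean (fun y => F (e1 lambda y)) - mean f1| <= 2 * pi * d (q + k0)%N.
  apply: mean_dist_le => //.
    exact: bounded_measurable_comp (measurable_e1 lambda) bF.
  move=> y /e1_01' /Psi01 /andP[P0 P1]; rewrite /F /f1 -mulrBr normrM.
  rewrite ger0_norm // (@le_trans _ _ (1 * (2 * pi * d (q + k0)%N))) ?mul1r //.
  have [n Hn] := dist_int (q + k0)%N.
  rewrite -[X in _ <= X]mul1r ler_pM //.
  rewrite -[cos (2 * pi * _ * y - phi)](cosD_2pi_int _ n).
  apply: le_trans (cos_lipschitz _ _) _.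
  have -> : 2 * pi * lambda ^- (q.+1 + k0) * e1 lambda y - phi -
    (2 * pi * lambda ^- (q + k0) * y - phi + 2 * pi * n%:~R) =
    2 * pi * ((1 - lambda) * lambda ^- (q + k0).+1 - n%:~R).
    rewrite /e1 addSn exprSr; field; rewrite l0 expf_neq0 //.
  by rewrite normrM ger0_norm ?ler_wpM2l // ?mulr_ge0 ?pi_ge0.
rewrite (mean_self_similar bF) (mean_self_similar bPsi) E0 addnC.
move: I0 I1 E1; rewrite -/f0 -/f1 !ler_norml.
set P0 := mean (fun x => Psi (e0 _ _)); set P1 := mean (fun x => Psi (e1 _ _)).
set a0 := mean f0; set a1 := mean f1; set a2 := mean _.
set D := 2 * pi * d _.
move=> /andP[? ?] /andP[? ?] /andP[? ?]; apply/andP; split; nra.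
Qed.

End zooming.

Lemma sum_geometric_tail (R : realFieldType) (x : R) (a n : nat) :
  0 <= x -> x < 1 -> \sum_(j < n) x ^+ (a + j) <= x ^+ a / (1 - x).
Proof.
move=> x0 x1; have d0 : 0 < 1 - x by rewrite subr_gt0.
rewrite ler_pdivlMr // mulrC.
suff -> : (1 - x) * \sum_(j < n) x ^+ (a + j) = x ^+ a - x ^+ (a + n).
  by rewrite gerBl exprn_ge0.
elim: n => [|n IHn]; first by rewrite big_ord0 mulr0 addn0 subrr.
by rewrite big_ord_recr /= mulrDr IHn addnS exprS; ring.
Qed.

(** From a large [N] on, the product of the factors 1 - C x ^ k is at least 1 minus the sum of the C
    x ^ k, hence at least 1 / 2; the finitely many earlier terms are nonzero and have a positive
    minimum. *)
Lemma lower_bound_of_ratios (R : realType) (a : nat -> R) (C x : R) :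
  0 <= C -> 0 <= x -> x < 1 -> (forall k, a k != 0) ->
  (forall k, (1 - C * x ^+ k) * `|a k| <= `|a k.+1|) ->
  exists2 p : R, 0 < p & forall k, p <= `|a k|.
Proof.
move=> C0 x0 x1 a0 ratio.
have finite n : exists2 p : R, 0 < p & forall k, (k <= n)%N -> p <= `|a k|.
  elim: n => [|n [p p0 pn]].
    by exists `|a 0%N|; rewrite ?normr_gt0 // => k; rewrite leqn0 => /eqP->.
  exists (Num.min p `|a n.+1|); first by rewrite lt_min p0 normr_gt0 a0.
  move=> k; rewrite leq_eqVlt ltnS => /orP[/eqP->|/pn pk].
    by rewrite ge_min lexx orbT.
  by rewrite ge_min pk.
have d0 : 0 < 1 - x by rewrite subr_gt0.
(* This threshold for x ^ N makes the tail C x ^ N / (1 - x) at most 1 / 2. *)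
have e0 : 0 < (1 - x) / (2 * (C + 1)) by rewrite divr_gt0 // mulr_gt0 // ltr_wpDl.
have [N HN] := exp_eventually_lt x0 x1 e0.
have HN' : x ^+ N * (2 * (C + 1)) < 1 - x.
  by have := HN N (leqnn N); rewrite ltr_pdivlMr // mulr_gt0 // ltr_wpDl.
have xN0 := exprn_ge0 N x0.
have xN : C * (x ^+ N / (1 - x)) <= 2^-1.
  rewrite mulrA ler_pdivrMr //; nra.
have CxN : C * x ^+ N <= 1 by nra.
have tail j : (1 - C * \sum_(i < j) x ^+ (N + i)) * `|a N| <= `|a (N + j)%N|.
  elim: j => [|j IHj]; first by rewrite big_ord0 mulr0 subr0 mul1r addn0.
  rewrite addnS; apply: le_trans (ratio _); rewrite big_ord_recr /=.
  set S := \sum_(i < j) _ in IHj *; set y := x ^+ (N + j).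
  have y0 : 0 <= y by exact: exprn_ge0.
  have S0 : 0 <= S by apply: sumr_ge0 => i _; exact: exprn_ge0.
  have y1 : C * y <= 1.
    by rewrite /y exprD mulrA mulr_ile1 ?mulr_ge0 ?exprn_ge0 ?exprn_ile1 // ltW.
  have := ler_wpM2l (_ : 0 <= 1 - C * y) IHj; rewrite subr_ge0 => /(_ y1).
  apply: le_trans; rewrite mulrA ler_wpM2r //.
  have : 0 <= C * y * (C * S) by rewrite !mulr_ge0.
  lra.
have [p p0 pk] := finite N.
exists (p / 2) => [|k]; first by rewrite divr_gt0.
have [/pk|] := leqP k N; first by apply: le_trans; lra.
move=> /ltnW Nk; rewrite -(subnKC Nk); apply: le_trans (tail _).
have := ler_wpM2l C0 (sum_geometric_tail N (k - N) x0 x1).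
have := pk N (leqnn N); set S := \sum_(i < _) _.
nra.
Qed.

(** * Products of squared cosines *)

Section trigonometric_products.
Variable R : realType.
Implicit Types (l : seq R) (t u : R).

Lemma cos2_norm_le1 t : 0 <= cos t ^+ 2 <= 1.
Proof. by rewrite sqr_ge0 /= cos2sin2 gerBl sqr_ge0. Qed.

Lemma prod_cos2_01 l t : 0 <= \prod_(a <- l) cos (a * t) ^+ 2 <= 1.
Proof.
elim: l => [|a l /andP[IH0 IH1]]; first by rewrite big_nil ler01 lexx.
have /andP[c0 c1] := cos2_norm_le1 (a * t).
by rewrite big_cons mulr_ge0 // mulr_ile1.
Qed.

Lemma prod_cos2_ge l t :
  1 - \sum_(a <- l) (a * t) ^+ 2 <= \prod_(a <- l) cos (a * t) ^+ 2.
Proof.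
elim: l => [|a l IH]; first by rewrite !big_nil subr0.
rewrite !big_cons cos2sin2.
have /andP[P0 P1] := prod_cos2_01 l t.
have : sin (a * t) ^+ 2 <= (a * t) ^+ 2.
  rewrite -[leLHS]real_normK ?num_real // -[leRHS]real_normK ?num_real //.
  by rewrite lerXn2r ?nnegrE // sin_norm_le.
have := sqr_ge0 (sin (a * t)); nra.
Qed.

Lemma prod_cos2_dist l t u :
  `|\prod_(a <- l) cos (a * t) ^+ 2 - \prod_(a <- l) cos (a * u) ^+ 2|
    <= (\sum_(a <- l) `|a|) * (2 * `|t - u|).
Proof.
elim: l => [|a l IH]; first by rewrite !big_nil subrr normr0 mul0r.
rewrite !big_cons; set P := \prod_(_ <- _) _ in IH *; set Q := \prod_(_ <- _) _ in IH *.
set ct := cos (a * t); set cu := cos (a * u).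
have -> : ct ^+ 2 * P - cu ^+ 2 * Q = ct ^+ 2 * (P - Q) + (ct - cu) * (ct + cu) * Q.
  by ring.
rewrite [leRHS]mulrDl [leRHS]addrC; apply: le_trans (ler_normD _ _) _; apply: lerD.
  apply: le_trans IH; rewrite normrM ler_piMl // ger0_norm ?sqr_ge0 //.
  by have /andP[] := cos2_norm_le1 (a * t).
have /andP[Q0 Q1] := prod_cos2_01 l u.
rewrite normrM (ger0_norm Q0) (@le_trans _ _ `|(ct - cu) * (ct + cu)|) ?ler_piMr //.
rewrite normrM mulrC.
apply: (@le_trans _ _ (2 * (`|a| * `|t - u|))); last by rewrite mulrCA.
apply: ler_pM => //.
  apply: le_trans (ler_normD _ _) _.
  by have := cos_max (a * t); have := cos_max (a * u); rewrite -/ct -/cu; lra.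
by rewrite -normrM mulrBr cos_lipschitz.
Qed.

Lemma measurable_prod_cos2 l (G : R -> R) :
  measurable_fun [set: measurableTypeR R] G ->
  bounded_measurable (fun x => \prod_(a <- l) cos (a * G x) ^+ 2).
Proof.
move=> mG; elim: l => [|a l IH].
  have -> : (fun x => \prod_(a <- [::]) cos (a * G x) ^+ 2) = fun=> 1.
    by apply/funext => x; rewrite big_nil.
  exact: bounded_measurable_cst.
have -> : (fun x => \prod_(i <- a :: l) cos (i * G x) ^+ 2) =
    fun x => (cos (a * G x) * cos (a * G x)) * \prod_(i <- l) cos (i * G x) ^+ 2.
  by apply/funext => x; rewrite big_cons.
have bc : bounded_measurable (fun x => cos (a * G x)).
  by apply: bounded_measurable_cos; apply: measurable_funM.
by apply: bounded_measurableM => //; exact: bounded_measurableM.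
Qed.

(* 4 cos^2 (a t) cos (w t) = 2 cos (w t) + cos ((w + 2 a) t) + cos ((w - 2 a) t):
   the localized integral is a convex combination of shifted frequencies. *)
Lemma mean_prod_cos2 (mu : probability (measurableTypeR R) R) (G : R -> R) l w B :
  measurable_fun [set: measurableTypeR R] G ->
  (forall w' phi, `|w' - w| <= 2 * \sum_(a <- l) `|a| ->
    `|mean mu (fun x => cos (w' * G x - phi))| <= B) ->
  forall phi, `|mean mu (fun x => (\prod_(a <- l) cos (a * G x) ^+ 2)
    * cos (w * G x - phi))| <= B.
Proof.
move=> mG; elim: l w => [|a l IH] w H phi.
  have -> : (fun x => \prod_(a <- [::]) cos (a * G x) ^+ 2 * cos (w * G x - phi)) =
      fun x => cos (w * G x - phi).
    by apply/funext => x; rewrite big_nil mul1r.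
  by apply: H; rewrite subrr normr0 big_nil mulr0.
pose F v x := \prod_(i <- l) cos (i * G x) ^+ 2 * cos (v * G x - phi).
have bF v : bounded_measurable (F v).
  apply: bounded_measurableM; first exact: measurable_prod_cos2.
  apply: bounded_measurable_cos; apply: measurable_funB => //.
  exact: measurable_funM.
have FB v : `|v - w| <= 2 * `|a| -> `|mean mu (F v)| <= B.
  move=> vw; apply: IH => w' phi' w'v; apply: H.
  rewrite big_cons mulrDr; apply: le_trans (ler_distD v _ _) _.
  by rewrite addrC lerD.
have -> : (fun x => \prod_(i <- a :: l) cos (i * G x) ^+ 2 * cos (w * G x - phi)) =
    fun x => (2^-1 * F w x + 4^-1 * F (w + 2 * a) x) + 4^-1 * F (w - 2 * a) x.
  apply/funext => x; rewrite /F big_cons.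
  have -> : (w + 2 * a) * G x - phi = (w * G x - phi) + (a * G x) *+ 2.
    by rewrite -mulr_natl; ring.
  have -> : (w - 2 * a) * G x - phi = (w * G x - phi) - (a * G x) *+ 2.
    by rewrite -mulr_natl; ring.
  have c2 : cos ((a * G x) *+ 2) = 2 * cos (a * G x) ^+ 2 - 1.
    by rewrite cos_mulr2n -[_ ^+ 2 *+ 2]mulr_natl.
  by set A := w * G x - phi; rewrite (cosD A) (cosB A) c2; field.
rewrite meanD; [|by apply: bounded_measurableD; apply: bounded_measurableZ|
  exact: bounded_measurableZ].
rewrite meanD; [|exact: bounded_measurableZ|exact: bounded_measurableZ].
rewrite !meanZ //.
have h0 : `|mean mu (F w)| <= B by apply: FB; rewrite subrr normr0 mulr_ge0.
have h1 : `|mean mu (F (w + 2 * a))| <= B.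
  by apply: FB; rewrite addrAC subrr add0r normrM ger0_norm.
have h2 : `|mean mu (F (w - 2 * a))| <= B.
  by apply: FB; rewrite addrAC subrr add0r normrN normrM ger0_norm.
move: h0 h1 h2; rewrite !ler_norml.
move=> /andP[? ?] /andP[? ?] /andP[? ?]; apply/andP; split; lra.
Qed.

End trigonometric_products.

(** * Lower bound for the Fourier transform along powers of 1 / lambda *)

Section centered_fourier.
Variables (R : realType) (lambda : R).
Variable mu : probability (measurableTypeR R) R.
Hypotheses (lambda_gt0 : 0 < lambda) (lambda_lt : lambda < 1 / 2).
Hypothesis mu_bernoulli : is_bernoulli_convolution lambda mu.
Local Notation mean := (mean mu).

Let lambda_lt1 : lambda < 1.
Proof. by apply: lt_trans lambda_lt _; lra. Qed.

(** The transform recentered at the point of symmetry 1 / 2 of the measure, hence real; classically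
    the product over j >= 0 of cos (pi (1 - lambda) lambda ^ j theta). *)
Definition centered_fourier (theta : R) : R :=
  mean (fun z => cos (2 * pi * theta * (z - 1 / 2))).

Let bcos (a b : R) : bounded_measurable (fun y => cos (a * y - b)).
Proof. by apply: bounded_measurable_cos; apply: measurable_funB. Qed.

Let bcos' (a : R) : bounded_measurable (fun y => cos (a * (y - 1 / 2))).
Proof.
have -> : (fun y => cos (a * (y - 1 / 2))) = fun y => cos (a * y - a * (1 / 2)).
  by apply/funext => y; rewrite mulrBr.
exact: bcos.
Qed.

(** The two halves carry the phases u - v and u + v, so their sine terms cancel. *)
Lemma centered_fourier_step (theta : R) : centered_fourier theta =
  cos (pi * ((1 - lambda) * theta)) * centered_fourier (lambda * theta).
Proof.
have bcs := bcos' (2 * pi * (lambda * theta)).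
rewrite /centered_fourier -meanZ // (mean_self_similar mu_bernoulli) //.
have b0 := bounded_measurable_comp (measurable_e0 lambda) (bcos' (2 * pi * theta)).
have b1 := bounded_measurable_comp (measurable_e1 lambda) (bcos' (2 * pi * theta)).
rewrite -meanZ // -meanZ // -meanD; [|exact: bounded_measurableZ|exact: bounded_measurableZ].
congr (mean _); apply/funext => z; rewrite /e0 /e1.
set u := 2 * pi * (lambda * theta) * (z - 1 / 2).
set v := pi * ((1 - lambda) * theta).
have -> : 2 * pi * theta * (lambda * z - 1 / 2) = u - v by rewrite /u /v; field.
have -> : 2 * pi * theta * (lambda * z + 1 - lambda - 1 / 2) = u + v.
  by rewrite /u /v; field.
by rewrite cosB cosD; field.
Qed.

Lemma cos_pi_neq0 (x : R) : -1 / 2 < x -> x < 1 -> x != 1 / 2 -> cos (pi * x) != 0.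
Proof.
move=> x0 x1 xh; apply/eqP => /cos_pi_eq0 [n xn].
have n0 : n%:~R < (1 : R) by lra.
have n1 : (-1)%:~R < (n%:~R : R) by rewrite rmorphN /=; lra.
move: n0 n1; rewrite -[1]/(1%:~R) !ltr_int => n0 n1.
have n00 : n = 0 by lia.
by move: xh; rewrite xn n00 add0r mul1r eqxx.
Qed.

(** At frequency 1 the phase fills [-pi, pi], too wide for a direct bound. Two steps split off
    nonzero factors, at 1 - lambda in (1/2, 1) and at lambda (1 - lambda) in (0, 1/4), and leave
    frequency lambda ^ 2 < 1 / 4, where the phase is below 1 in modulus. *)
Lemma centered_fourier1_neq0 : centered_fourier 1 != 0.
Proof.
have ll := lambda_lt; have l0 := lambda_gt0.
have l4 : lambda * lambda < 4^-1 by nra.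
rewrite centered_fourier_step mulf_neq0 //.
  by rewrite mulr1; apply: cos_pi_neq0; [lra|lra|rewrite gt_eqF //; lra].
rewrite centered_fourier_step mulf_neq0 //.
  by rewrite mulr1; apply: cos_pi_neq0; [nra|nra|rewrite lt_eqF //; nra].
rewrite gt_eqF //; set a := lambda * _.
have pi4 : pi < 4 :> R by have := pihalf_lt2 R; lra.
have pi0 := pi_gt0 R.
have a0 : 0 < pi * a by rewrite /a !mulr_gt0.
have a1 : pi * a < 1 by rewrite /a mulr1; nra.
have c1 := bounded_measurable_cst (1 : R).
suff : `|centered_fourier a - 1| <= pi * a by rewrite ler_norml => /andP[? ?]; lra.
rewrite -[X in _ - X](mean_cst mu).
apply: (mean_dist_le lambda_gt0 lambda_lt1 mu_bernoulli) => // x /andP[x0 x1].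
rewrite -[X in _ - X]cos0; apply: le_trans (cos_lipschitz _ _) _; rewrite subr0.
by rewrite ler_norml; apply/andP; split; nra.
Qed.

(** Consecutive values differ by a nonzero cosine of modulus at least 1 - (pi D rho ^ k) ^ 2, by
    closeness of its argument to a multiple of pi; such factors have a convergent product. *)
Lemma centered_fourier_lower : pisot lambda^-1 ->
  exists2 p : R, 0 < p & forall k : nat, p <= `|centered_fourier (lambda ^- k)|.
Proof.
move=> lp; have [D [rho [D0 rho0 rho1 near]]] := pisot_diff_near_integer lp.
have l0 : lambda != 0 by rewrite gt_eqF.
have step k : centered_fourier (lambda ^- k.+1) =
    cos (pi * (lambda^-1 ^+ k.+1 - lambda^-1 ^+ k)) * centered_fourier (lambda ^- k).
  rewrite centered_fourier_step; congr (cos (pi * _) * centered_fourier _);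
    by rewrite ?exprVn !exprS; field; rewrite l0 expf_neq0.
apply: (@lower_bound_of_ratios _ _ ((pi * D) ^+ 2) rho);
  rewrite ?sqr_ge0 ?(ltW rho0) //.
- elim=> [|k IHk]; first by rewrite expr0 invr1 centered_fourier1_neq0.
  by rewrite step mulf_neq0 // pisot_cos_neq0.
move=> k; rewrite step normrM ler_wpM2r //.
have [n nearn] := near k.
apply: le_trans (norm_cos_pi_ge _ n); rewrite lerB //.
rewrite -[leLHS]real_normK ?num_real //.
have rk0 := exprn_ge0 k (ltW rho0).
have rk1 : rho ^+ k <= 1 by rewrite exprn_ile1 // ltW.
apply: (@le_trans _ _ ((pi * D * rho ^+ k) ^+ 2)).
  rewrite lerXn2r ?nnegrE // ?mulr_ge0 ?pi_ge0 //.
  by rewrite normrM ger0_norm ?pi_ge0 // -mulrA ler_wpM2l ?pi_ge0.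
by rewrite exprMn ler_wpM2l ?sqr_ge0 // expr2 ler_piMl.
Qed.

End centered_fourier.

(** * Localization at the left endpoint *)

Section localizer.
Variables (R : realType) (lambda b : R) (M : nat).
Hypotheses (lambda_gt0 : 0 < lambda) (lambda_lt : lambda < 1 / 2).
Hypotheses (b_gt0 : 0 < b).

(* The multiplicity M * (k + 1) grows with the distance k to the finest scale:
   points at distance about lambda ^ (n - k) are damped by the factor
   rho ^ (M k), which beats the mass 2 ^ (k - n) they carry, while near the
   origin the product stays close to 1 because sum_k k lambda ^ k <= 2. *)
Definition localizer_freqs (n : nat) : seq R :=
  flatten [seq nseq (M * k.+1) (b * lambda ^+ k.+1 * lambda ^- n) | k <- iota 0 n].

Lemma sum_localizer_freqs (f : R -> R) n :
  \sum_(a <- localizer_freqs n) f a =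
  \sum_(k < n) (M * k.+1)%:R * f (b * lambda ^+ k.+1 * lambda ^- n).
Proof.
rewrite /localizer_freqs big_flatten big_map -(subn0 n) -/(index_iota 0 n) subn0.
rewrite big_mkord; apply: eq_bigr => k _.
by rewrite big_nseq iter_addr_0 mulr_natl.
Qed.

Lemma sum_natmul_geometric (x : R) n : 0 <= x -> x <= 1 / 2 ->
  \sum_(k < n) k.+1%:R * x ^+ k.+1 <= 2.
Proof.
move=> x0 x2; apply: (@le_trans _ _ (\sum_(k < n) k.+1%:R * 2 ^- k.+1)).
  apply: ler_sum => k _; rewrite ler_wpM2l // -exprVn lerXn2r ?nnegrE ?invr_ge0 //.
  by rewrite -[2^-1]mul1r.
suff -> : \sum_(k < n) k.+1%:R * 2 ^- k.+1 = 2 - (n%:R + 2) * 2 ^- n :> R.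
  by rewrite gerBl mulr_ge0 ?invr_ge0 ?exprn_ge0 // addr_ge0.
elim: n => [|n IHn]; first by rewrite big_ord0 expr0 invr1 add0r mulr1 subrr.
rewrite big_ord_recr /= IHn exprS -!natr1; field.
by rewrite expf_neq0 // pnatr_eq0.
Qed.

(** Bandwidth of the localizer: it shifts frequencies by at most twice this sum. *)
Lemma sum_localizer_freqs_norm n :
  \sum_(a <- localizer_freqs n) `|a| <= 2 * M%:R * b * lambda ^- n.
Proof.
have ln0 : 0 < lambda ^- n by rewrite invr_gt0 exprn_gt0.
rewrite sum_localizer_freqs.
under eq_bigr => k _.
  rewrite ger0_norm; last by rewrite !mulr_ge0 ?exprn_ge0 // ltW.
  rewrite natrM (_ : _ * _ =
    M%:R * b * lambda ^- n * (k.+1%:R * lambda ^+ k.+1)); last by ring.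
  over.
rewrite -mulr_sumr -[leRHS]mulrA -[leRHS]mulrA [leRHS]mulrC.
rewrite -[X in X * _ <= _]mulrA ler_wpM2l ?mulr_ge0 ?(ltW b_gt0) ?(ltW ln0) //.
by apply: sum_natmul_geometric; apply: ltW.
Qed.

(** The angles of level [k] are at most lambda ^ (k + 1) lambda ^ m in modulus. As lambda ^ 2 <= 1 /
    4, their squares are at most lambda ^ (k + 1) 4 ^ -m, summable against the multiplicities. *)
Lemma localizer_lower n m t : b * `|t| <= lambda ^+ (n + m) ->
  1 - 2 * M%:R * 4 ^- m <= \prod_(a <- localizer_freqs n) cos (a * t) ^+ 2.
Proof.
move=> bt; apply: le_trans (prod_cos2_ge _ _); rewrite lerB //.
have l0 : lambda != 0 by rewrite gt_eqF.
rewrite (sum_localizer_freqs (fun a => (a * t) ^+ 2)).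
apply: (@le_trans _ _ (\sum_(k < n) M%:R * 4 ^- m * (k.+1%:R * lambda ^+ k.+1))).
  apply: ler_sum => k _; rewrite natrM.
  rewrite (_ : M%:R * 4 ^- m * (k.+1%:R * lambda ^+ k.+1) =
    M%:R * k.+1%:R * (lambda ^+ k.+1 * 4 ^- m)); last by ring.
  rewrite ler_wpM2l //.
  have -> : b * lambda ^+ k.+1 / lambda ^+ n * t = lambda ^+ k.+1 * (b * t / lambda ^+ n).
    by ring.
  have lk1 : lambda ^+ k.+1 <= 1 by rewrite exprn_ile1 // ltW //; have := lambda_lt; lra.
  have lk0 : 0 < lambda ^+ k.+1 by rewrite exprn_gt0.
  rewrite exprMn; apply: ler_pM; rewrite ?sqr_ge0 //.
    by rewrite expr2 ler_piMl // ltW.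
  have ub : `|b * t / lambda ^+ n| <= lambda ^+ m.
    rewrite normrM normrM (gtr0_norm b_gt0) normfV (gtr0_norm (exprn_gt0 n lambda_gt0)).
    by rewrite ler_pdivrMr ?exprn_gt0 // -exprD addnC.
  rewrite -real_normK ?num_real // (@le_trans _ _ ((lambda ^+ m) ^+ 2)) //.
    by rewrite lerXn2r ?nnegrE ?exprn_ge0 // ltW.
  rewrite -exprM mulnC exprM -exprVn lerXn2r ?nnegrE ?sqr_ge0 ?invr_ge0 //.
  by have := lambda_lt; have := lambda_gt0; nra.
rewrite -mulr_sumr -[leRHS]mulrA [leRHS]mulrC ler_wpM2l ?mulr_ge0 ?invr_ge0 ?exprn_ge0 //.
by apply: sum_natmul_geometric; apply: ltW.
Qed.

(** One level is enough: for k = n - i - 1 the frequency is b lambda ^ -i, its multiplicity M (n -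
    i), and the angle lies in [c, 1], where cos is at most cos c. All other factors are at most
    1. *)
Lemma localizer_upper n i t (c : R) : (i < n)%N ->
  (b * t / lambda ^+ i) \in `[c, 1] -> 0 <= c ->
  \prod_(a <- localizer_freqs n) cos (a * t) ^+ 2 <= cos c ^+ 2 ^+ (M * (n - i)).
Proof.
move=> i_lt; rewrite in_itv /= => /andP[ct t1] c0.
have l0 : lambda != 0 by rewrite gt_eqF.
rewrite /localizer_freqs big_flatten big_map -(subn0 n) -/(index_iota 0 n) subn0.
rewrite big_mkord; under eq_bigr => k _ do rewrite big_nseq iter_mulr_1.
have ni : (n - i.+1 < n)%N by rewrite subnSK // leq_subr.
rewrite (bigD1 (Ordinal ni)) //= subnSK //.
have H01 (k : nat) : 0 <= (cos (b * lambda ^+ k.+1 / lambda ^+ n * t) ^+ 2) ^+ (M * k.+1) <= 1.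
  have /andP[x0 x1] := cos2_norm_le1 (b * lambda ^+ k.+1 / lambda ^+ n * t).
  by rewrite exprn_ge0 // exprn_ile1.
apply: (@le_trans _ _ ((cos (b * lambda ^+ (n - i) / lambda ^+ n * t) ^+ 2) ^+ (M * (n - i)))).
  rewrite ler_piMr // ?(exprn_ge0 _ (sqr_ge0 _)) //.
  by apply: Num.Theory.prodr_ile1 => k _.
have -> : b * lambda ^+ (n - i) / lambda ^+ n * t = b * t / lambda ^+ i.
  rewrite -[in lambda ^+ n](subnK (ltnW i_lt)) exprD; field.
  by rewrite !expf_neq0.
have p2 := pi_ge2 R.
have pih : 1 <= pi / 2 :> R by exact: pihalf_ge1.
have cos0 (x : R) : 0 <= x -> x <= 1 -> 0 <= cos x.
  by move=> x0 x1; apply: cos_ge0_pihalf; apply/andP; split; lra.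
set u := b * t / _ in ct t1 *.
have cu0 : 0 <= cos u by apply: cos0 => //; exact: le_trans ct.
have cc0 : 0 <= cos c by apply: cos0 => //; exact: le_trans t1.
have cuc : cos u <= cos c.
  have cI : c \in `[0, pi] by rewrite in_itv /= c0 /=; lra.
  have uI : u \in `[0, pi] by rewrite in_itv /= (le_trans c0) //=; lra.
  by rewrite leNgt ltr_cos // -leNgt.
by rewrite lerXn2r ?nnegrE ?sqr_ge0 // lerXn2r ?nnegrE.
Qed.

End localizer.

Section localized_lower_bound.
Variables (R : realType) (lambda : R).
Variable mu : probability (measurableTypeR R) R.
Hypotheses (lambda_gt0 : 0 < lambda) (lambda_lt : lambda < 1 / 2).
Hypothesis mu_bernoulli : is_bernoulli_convolution lambda mu.
Local Notation mean := (mean mu).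
Variables (G : R -> R) (K s c : R).
Hypothesis measurable_G : measurable_fun [set: measurableTypeR R] G.
Hypotheses (K_ge0 : 0 <= K) (s_gt1 : 1 < s) (c_gt0 : 0 < c).
Hypothesis G_linear : forall x : R, 0 <= x <= 1 -> `|G x - x| <= K * x `^ s.
Hypothesis G_ge : forall x : R, 0 <= x <= 1 -> c * x <= `|G x|.

Let lambda_lt1 : lambda < 1.
Proof. by apply: lt_trans lambda_lt _; lra. Qed.

(** Normalized so that b |G x| <= x: for x <= lambda ^ i the angle b G x / lambda ^ i stays within
    [-1, 1]. *)
Let b : R := (1 + K)^-1.

Let b_gt0 : 0 < b.
Proof. by rewrite invr_gt0 ltr_pwDl. Qed.

Lemma G_le (x : R) : 0 <= x <= 1 -> b * `|G x| <= x.
Proof.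
move=> x01; have /andP[x0 x1] := x01.
rewrite /b ler_pdivrMl ?ltr_pwDl //.
have xs : x `^ s <= x.
  have [->|xn0] := eqVneq x 0; first by rewrite powR0 // gt_eqF // (lt_trans ltr01).
  by apply: ge1r_powR; [rewrite lt_def xn0 x0|exact: ltW].
rewrite -[G x](subrK x) (le_trans (ler_normD _ _)) // (ger0_norm x0) mulrDl mul1r.
by rewrite addrC lerD2l (le_trans (G_linear x01)) // ler_wpM2l.
Qed.

Lemma scale01 n (x : R) : 0 <= x <= 1 -> 0 <= lambda ^+ n * x <= 1.
Proof.
move=> /andP[x0 x1]; have l0 := ltW lambda_gt0; have l1 := ltW lambda_lt1.
by rewrite mulr_ge0 ?exprn_ge0 //= mulr_ile1 // ?exprn_ge0 ?exprn_ile1.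
Qed.

Lemma scale_powR n a (x : R) : a%:R <= n%:R * s -> 0 <= x <= 1 ->
  (lambda ^+ n * x) `^ s <= lambda ^+ a.
Proof.
move=> an x01; have /andP[x0 x1] := x01.
have l0 := ltW lambda_gt0; have s0 : 0 <= s by rewrite (le_trans ler01) // ltW.
rewrite -!powR_mulrn // powRM ?powR_ge0 // -powRrM -[leRHS]mulr1.
apply: ler_pM; rewrite ?powR_ge0 //.
  by apply: ger_powR => //; rewrite lambda_gt0 ltW.
apply: le_trans (_ : 1 `^ s <= 1); last by rewrite powR1.
by rewrite ge0_ler_powR // nnegrE.
Qed.

Lemma prod_cos2_norm (l : seq R) (t : R) :
  \prod_(a <- l) cos (a * `|t|) ^+ 2 = \prod_(a <- l) cos (a * t) ^+ 2.
Proof.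
apply: eq_bigr => a _; have [t0|t0] := ger0P t; first by [].
by rewrite mulrN cosN.
Qed.

(** [n] is the level of the cylinder, [m] the further levels after which the localizer is above 1 /
    2, [Q] the levels after which it is nearly constant, [k0] the start of the near-integer tail,
    [k2] the margin for the nonlinearity. The three errors are the oscillation of the localizer, the
    replacement of [G] by the identity and the accumulated phase drift; the final sum is the damped
    mass outside the cylinder. *)
Lemma localized_lower_bound (n m M k0 k2 Q : nat) (p D rho : R) :
  0 <= D -> 0 < rho -> rho < 1 -> 0 < p ->
  (forall k, exists z : int, `|(1 - lambda) * lambda ^- k.+1 - z%:~R| <= D * rho ^+ k) ->
  p <= `|centered_fourier mu (lambda ^- k0)| ->
  (n + Q + k0 + k2)%:R <= n%:R * s ->
  2 * M%:R * 4 ^- m <= 1 / 2 :> R ->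
  2 ^- n * (p * 2 ^- m / 2
    - (4 * M%:R * (1 + 2 * K) * lambda ^+ Q
       + 2 * pi * K * lambda ^+ k2 + 2 * pi * D * rho ^+ k0 / (1 - rho)))
  - \sum_(i < n) 2 ^- i.+1 * cos (b * c * (1 - lambda)) ^+ 2 ^+ (M * (n - i))
  <= `|mean (fun x => \prod_(a <- localizer_freqs lambda b M n) cos (a * G x) ^+ 2
       * cos (2 * pi * lambda ^- (n + Q + k0) * G x - pi * lambda ^- k0))|.
Proof.
move=> D0 rho0 rho1 p0 dist_int pk0 an Mm.
have pi0 := pi_ge0 R; have l0 := ltW lambda_gt0.
have ln0 : lambda != 0 by rewrite gt_eqF.
set l := localizer_freqs lambda b M n.
set w := 2 * pi * lambda ^- (n + Q + k0); set phi := pi * lambda ^- k0.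
have w0 : 0 <= w by rewrite !mulr_ge0 ?invr_ge0 ?exprn_ge0.
pose Phi t := \prod_(a <- l) cos (a * t) ^+ 2.
pose Psi y := Phi (G (lambda ^+ n * y)).
pose F x := Phi (G x) * cos (w * G x - phi).
have bPhi : bounded_measurable (fun x => Phi (G x)) by exact: measurable_prod_cos2.
have bPsi : bounded_measurable Psi by exact: (bounded_measurable_scale (lambda ^+ n) bPhi).
have bF : bounded_measurable F.
  apply: bounded_measurableM => //; apply: bounded_measurable_cos.
  by apply: measurable_funB => //; exact: measurable_funM.
have Phi01 t : 0 <= Phi t <= 1 by exact: prod_cos2_01.
have zoom : `|mean F - 2 ^- n * mean (fun y => F (lambda ^+ n * y))| <=
    \sum_(i < n) 2 ^- i.+1 * cos (b * c * (1 - lambda)) ^+ 2 ^+ (M * (n - i)).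
  apply: (mean_zoom (lambda := lambda) lambda_gt0 lambda_lt1 mu_bernoulli
    (t := fun i => cos (b * c * (1 - lambda)) ^+ 2 ^+ (M * (n - i)))) => // i y i_lt y01.
  have /andP[y0 y1] := e1_01 lambda_gt0 y01.
  have yy01 : 0 <= e1 lambda y <= 1.
    by rewrite y1 andbT (le_trans _ y0) // subr_ge0 ltW.
  set x := lambda ^+ i * _; have x01 : 0 <= x <= 1 by exact: scale01.
  have /andP[P0 P1] := Phi01 (G x).
  rewrite /F normrM (ger0_norm P0) (@le_trans _ _ (Phi (G x))) ?ler_piMr ?cos_max //.
  (* [G x] may be negative, but the product is even in its argument. *)
  rewrite /Phi -prod_cos2_norm; apply: localizer_upper => //.
    have li : 0 < lambda ^+ i by rewrite exprn_gt0.
    rewrite in_itv /= ler_pdivlMr // ler_pdivrMr // mul1r.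
    rewrite (le_trans (G_le x01)) ?ler_piMr ?(ltW li) // andbT.
    rewrite -mulrA -[leLHS]mulrA ler_wpM2l ?(ltW b_gt0) // -mulrA.
    by rewrite (le_trans _ (G_ge x01)) // ler_wpM2l ?(ltW c_gt0) // mulrC ler_wpM2l // ltW.
  by rewrite !mulr_ge0 ?(ltW b_gt0) ?(ltW c_gt0) // subr_ge0 ltW.
pose J1 := mean (fun y => Psi y * cos (2 * pi * lambda ^- (Q + k0) * y - phi)).
(* Linearizing changes the phase by at most w K lambda ^ (n s), and the hypothesis [an] leaves 2 pi
   K lambda ^ k2 of it. *)
have J01 : `|mean (fun y => F (lambda ^+ n * y)) - J1| <= 2 * pi * K * lambda ^+ k2.
  apply: (mean_dist_le lambda_gt0 lambda_lt1 mu_bernoulli).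
  - exact: bounded_measurable_scale.
  - apply: bounded_measurableM => //; apply: bounded_measurable_cos.
    by apply: measurable_funB => //; exact: measurable_funM.
  move=> y y01; rewrite /F -/(Psi y) -mulrBr normrM.
  have /andP[P0 P1] := Phi01 (G (lambda ^+ n * y)); rewrite (ger0_norm P0).
  rewrite (@le_trans _ _ `|cos (w * G (lambda ^+ n * y) - phi) -
     cos (2 * pi * lambda ^- (Q + k0) * y - phi)|) ?ler_piMl //.
  apply: le_trans (cos_lipschitz _ _) _.
  have -> : w * G (lambda ^+ n * y) - phi - (2 * pi * lambda ^- (Q + k0) * y - phi) =
      w * (G (lambda ^+ n * y) - lambda ^+ n * y).
    by rewrite /w -addnA exprD; field; rewrite !expf_neq0.
  rewrite normrM (ger0_norm w0).
  apply: le_trans (ler_wpM2l w0 (G_linear (scale01 n y01))) _.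
  apply: le_trans (ler_wpM2l w0 (ler_wpM2l K_ge0 (scale_powR an y01))) _.
  rewrite /w [lambda ^+ (n + Q + k0 + k2)]exprD le_eqVlt; apply/orP; left; apply/eqP.
  have : lambda ^+ (n + Q + k0) != 0 by rewrite expf_neq0.
  by set u := lambda ^+ (n + Q + k0) => u0; field.
pose delta := 4 * M%:R * (1 + 2 * K) * lambda ^+ Q.
have osc x y : 0 <= x <= 1 -> 0 <= y <= 1 -> `|x - y| <= lambda ^+ Q ->
    `|Psi x - Psi y| <= delta.
  move=> x01 y01 xy; apply: le_trans (prod_cos2_dist _ _ _) _.
  have ln : 0 < lambda ^+ n by rewrite exprn_gt0.
  (* Only |G x - x| <= K x ^ s is at hand, so the nonlinear parts are bounded separately at each
     point, by K lambda ^ (n + Q), since n + Q <= n s. *)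
  have GG : `|G (lambda ^+ n * x) - G (lambda ^+ n * y)| <=
      lambda ^+ n * ((1 + 2 * K) * lambda ^+ Q).
    have key z : 0 <= z <= 1 ->
        `|G (lambda ^+ n * z) - lambda ^+ n * z| <= K * (lambda ^+ n * lambda ^+ Q).
      move=> z01; apply: le_trans (G_linear (scale01 n z01)) _.
      rewrite ler_wpM2l // (le_trans (scale_powR an z01)) // -exprD.
      by rewrite ler_wiXn2l // ?(ltW lambda_lt1) // -addnA leq_addr.
    have -> : G (lambda ^+ n * x) - G (lambda ^+ n * y) =
      (G (lambda ^+ n * x) - lambda ^+ n * x) - (G (lambda ^+ n * y) - lambda ^+ n * y)
      + lambda ^+ n * (x - y) by ring.
    apply: le_trans (ler_normD _ _) _.
    apply: le_trans (lerD (ler_normB _ _) (lexx _)) _.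
    rewrite normrM (gtr0_norm ln).
    have := key x x01; have := key y y01; have := ler_wpM2l (ltW ln) xy.
    lra.
  have := sum_localizer_freqs_norm M lambda_gt0 lambda_lt b_gt0 n; rewrite -/l => HS.
  have b1 : b <= 1 by rewrite invf_le1 ?ltr_pwDl // lerDl.
  apply: (@le_trans _ _ ((2 * M%:R * b * lambda ^- n) *
     (2 * (lambda ^+ n * ((1 + 2 * K) * lambda ^+ Q))))).
    apply: ler_pM => //; rewrite ?mulr_ge0 //; last by rewrite ler_wpM2l.
    by apply: sumr_ge0.
  have -> : 2 * M%:R * b * lambda ^- n *
     (2 * (lambda ^+ n * ((1 + 2 * K) * lambda ^+ Q))) = b * delta.
    by rewrite /delta; field; rewrite !expf_neq0.
  rewrite ler_piMl // /delta !mulr_ge0 ?exprn_ge0 //.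
  by rewrite addr_ge0 // mulr_ge0.
have corr := @mean_correlation _ _ _ lambda_gt0 lambda_lt1 mu_bernoulli k0
  (fun k => D * rho ^+ k) phi delta dist_int Q Psi bPsi (fun x _ => Phi01 _) osc.
rewrite -/J1 in corr.
(* [phi] is the phase that recenters the measure at 1 / 2. *)
have cf : mean (fun z => cos (2 * pi * lambda ^- k0 * z - phi)) =
    centered_fourier mu (lambda ^- k0).
  rewrite /centered_fourier; congr (mean _); apply/funext => z; congr cos.
  by rewrite /phi; field; rewrite expf_neq0.
rewrite cf in corr.
have e2 : \sum_(j < Q) 2 * pi * (D * rho ^+ (k0 + j)) <= 2 * pi * D * rho ^+ k0 / (1 - rho).
  under eq_bigr do rewrite mulrA; rewrite -mulr_sumr -[leRHS]mulrA.
  by rewrite ler_wpM2l ?mulr_ge0 // sum_geometric_tail // ltW.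
have mPsi : 2 ^- m * (1 / 2) <= mean Psi.
  apply: (mean_zoom_ge lambda_gt0 lambda_lt1 mu_bernoulli) => //.
    by move=> x _; have /andP[] := Phi01 (G (lambda ^+ n * x)).
  move=> x x01; rewrite /Psi /Phi /l.
  apply: (le_trans _ (@localizer_lower _ _ _ M lambda_gt0 lambda_lt b_gt0 n m _ _)).
    by move: Mm; lra.
  apply: le_trans (G_le _) _; first by rewrite mulrA -exprD; exact: scale01.
  rewrite mulrA -exprD ler_piMr ?exprn_ge0 //.
  by have /andP[] := x01.
have n2 : 0 < 2 ^- n :> R by rewrite invr_gt0 exprn_gt0.
have J1_ge : p * 2 ^- m / 2 - (delta + 2 * pi * D * rho ^+ k0 / (1 - rho)) <= `|J1|.
  have : `|mean Psi * centered_fourier mu (lambda ^- k0)| <=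
      `|J1| + (delta + 2 * pi * D * rho ^+ k0 / (1 - rho)).
    rewrite -[X in `|X| <= _](subrK J1) [X in `|X| <= _]addrC.
    apply: le_trans (ler_normD _ _) _.
    rewrite lerD2l distrC; apply: le_trans corr _.
    by rewrite lerD2l.
  have m0 : 0 < 2 ^- m :> R by rewrite invr_gt0 exprn_gt0.
  have mP0 : 0 <= mean Psi by rewrite (le_trans _ mPsi) // mulr_ge0 // ltW.
  rewrite normrM (ger0_norm mP0) => H.
  have : p * (2 ^- m * (1 / 2)) <= mean Psi * `|centered_fourier mu (lambda ^- k0)|.
    by rewrite mulrC ler_pM // ?mulr_ge0 ?(ltW m0) ?(ltW p0).
  move: H; lra.
have J0_ge : p * 2 ^- m / 2 - (delta + 2 * pi * K * lambda ^+ k2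
      + 2 * pi * D * rho ^+ k0 / (1 - rho))
    <= `|mean (fun y => F (lambda ^+ n * y))|.
  set J0 := mean _ in J01 *.
  have := lerB_normD J1 (J0 - J1); rewrite [J1 + _]addrC subrK.
  move: J01 J1_ge; lra.
rewrite -/F -/delta lerBlDr.
apply: le_trans (ler_wpM2l (ltW n2) J0_ge) _.
rewrite -[X in X * _](gtr0_norm n2) -normrM.
rewrite -[X in `|X| <= _](subrK (mean F)) [X in `|X| <= _]addrC.
apply: le_trans (ler_normD _ _) _.
by rewrite lerD2l distrC.
Qed.

End localized_lower_bound.

(** * Choice of the constants and the contradiction *)

Lemma nat_gap (a n k0 k2 q : nat) : (n + (k0 + k2 + q) <= a)%N ->
  exists2 Q, a = (n + Q + k0 + k2)%N & (q <= Q)%N.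
Proof. by move=> H; exists (a - (n + k0 + k2))%N; lia. Qed.

Lemma mulexp_eventually_le (R : realType) (x C e : R) :
  0 <= x -> x < 1 -> 0 <= C -> 0 < e ->
  exists N, forall n, (N <= n)%N -> C * x ^+ n <= e.
Proof.
move=> x0 x1 C0 e0; have C1 : 0 < C + 1 by rewrite ltr_wpDl.
have [N HN] := exp_eventually_lt x0 x1 (divr_gt0 e0 C1).
exists N => n Nn; have := HN n Nn; rewrite ltr_pdivlMr // => /ltW.
by apply: le_trans; rewrite mulrC ler_wpM2l ?exprn_ge0 // lerDl.
Qed.

(** Read from i = n - 1 downwards, the terms are 2 ^ -n x (2 x) ^ j, a geometric series of ratio at
    most 1 / 2. *)
Lemma sum_halves_exp_le (R : realFieldType) (x : R) (n : nat) :
  0 <= x -> x <= 4^-1 ->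
  \sum_(i < n) 2 ^- i.+1 * x ^+ (n - i) <= 2 ^- n * (2 * x).
Proof.
move=> x0 x4.
(* The extra factor 1 - 2 ^ -n makes the induction close. *)
suff : \sum_(i < n) 2 ^- i.+1 * x ^+ (n - i) <= 2 ^- n * (2 * x) * (1 - 2 ^- n).
  by move/le_trans; apply; rewrite ler_piMr ?mulr_ge0 ?invr_ge0 ?exprn_ge0 //.
elim: n => [|n IHn]; first by rewrite big_ord0 expr0 invr1 subrr mulr0.
rewrite big_ord_recl /= subn0.
have -> : \sum_(i < n) 2 ^- (bump 0 i).+1 * x ^+ (n.+1 - bump 0 i) =
    2^-1 * \sum_(i < n) 2 ^- i.+1 * x ^+ (n - i).
  rewrite mulr_sumr; apply: eq_bigr => i _.
  by rewrite /bump /= add1n subSS [2 ^+ i.+2]exprS invfM mulrA.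
have xn : x ^+ n <= 2 ^- n * 2 ^- n.
  rewrite -invfM -exprMn -exprVn lerXn2r ?nnegrE ?invr_ge0 ?mulr_ge0 //.
  by apply: le_trans x4 _; rewrite -natrM.
have n0 : 0 < 2 ^- n :> R by rewrite invr_gt0 exprn_gt0.
have x1 := ler_wpM2l x0 xn.
have -> : 2 ^- n.+1 = 2^-1 * 2 ^- n :> R by rewrite exprS invfM.
rewrite expr1 [x ^+ n.+1]exprS; set y := 2 ^- n in IHn n0 xn x1 *.
set S := \sum_(_ < _) _ in IHn *; set z := x ^+ n in xn x1 *.
move: IHn x1; nra.
Qed.

Lemma decay_exponent_bound (R : realType) (lambda : R)
    (mu : probability (measurableTypeR R) R) (G : R -> R) (K s c tau B : R) :
  0 < lambda -> lambda < 1 / 2 -> pisot lambda^-1 ->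
  is_bernoulli_convolution lambda mu ->
  measurable_fun [set: measurableTypeR R] G ->
  0 <= K -> 1 < s -> 0 < c ->
  (forall x : R, 0 <= x <= 1 -> `|G x - x| <= K * x `^ s) ->
  (forall x : R, 0 <= x <= 1 -> c * x <= `|G x|) ->
  0 < tau -> 0 <= B ->
  (forall w phi : R, w != 0 ->
     `|mean mu (fun x => cos (w * G x - phi))| <= B * `|w| `^ (- tau)) ->
  tau <= ln 2 / (- ln lambda * s).
Proof.
move=> l_gt0 l_lt lp mu_b mG K0 s1 c0 GK Gc tau0 B0 decay.
have l_lt1 : lambda < 1 by apply: lt_trans l_lt _; lra.
have l0 := ltW l_gt0; have pi0 := pi_gt0 R.
have ln0 : lambda != 0 by rewrite gt_eqF.
have lnl : ln lambda < 0 by rewrite ln_lt0 // l_gt0.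
have s0 : 0 < s by rewrite (lt_trans ltr01).
rewrite leNgt; apply/negP; rewrite ltr_pdivrMr ?mulr_gt0 ?oppr_gt0 // => tau_lt.
(* Ratio of the decay rate lambda ^ (s tau) to the cylinder mass rate 1 / 2; it is below 1 exactly
   when [tau] exceeds the claimed bound. *)
pose theta := 2 * lambda `^ (s * tau).
have theta0 : 0 < theta by rewrite mulr_gt0 // powR_gt0.
have theta1 : theta < 1.
  rewrite /theta mulrC -ltr_pdivlMr // mul1r -ltr_ln ?posrE ?powR_gt0 ?invr_gt0 //.
  by rewrite ln_powR lnV ?posrE //; move: tau_lt; lra.
pose b : R := (1 + K)^-1.
have b0 : 0 < b by rewrite invr_gt0 ltr_pwDl.
have b1 : b <= 1 by rewrite invf_le1 ?ltr_pwDl // lerDl.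
have [p p0 pk] := centered_fourier_lower l_gt0 l_lt mu_b lp.
have [D [rho [D0 rho0 rho1 dist_int]]] := pisot_diff_near_integer lp.
have {}dist_int k : exists z : int,
    `|(1 - lambda) * lambda ^- k.+1 - z%:~R| <= D * rho ^+ k.
  have [z Hz] := dist_int k; exists z; move: Hz.
  suff -> : lambda^-1 ^+ k.+1 - lambda^-1 ^+ k = (1 - lambda) * lambda ^- k.+1 by [].
  by rewrite ?exprVn !exprS; field; rewrite ln0 expf_neq0.
pose r := cos (b * c * (1 - lambda)) ^+ 2.
have r0 : 0 <= r by exact: sqr_ge0.
have r1 : r < 1.
  rewrite /r cos2sin2 gtrBl exprn_gt0 // sin_gt0_pi // !mulr_gt0 ?subr_gt0 //=.
  apply: le_lt_trans (_ : 1 < pi); last by have := pi_ge2 R; lra.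
  have bc1 : b * c <= 1.
    have x01 : 0 <= (1 : R) <= 1 by rewrite ler01 lexx.
    have := G_le K0 s1 GK x01; apply: le_trans; rewrite ler_wpM2l ?(ltW b0) //.
    by have := Gc 1 x01; rewrite mulr1.
  by rewrite mulr_ile1 // ?mulr_ge0 ?(ltW b0) ?(ltW c0) ?subr_ge0 ?(ltW l_lt1) ?gerBl.
have [L HL] := @exp_eventually_lt _ r 4^-1 r0 r1 ltac:(by rewrite invr_gt0).
have {}HL := ltW (HL L (leqnn L)).
have h0 : 0 <= 2^-1 :> R by rewrite invr_ge0.
have h1 : 2^-1 < 1 :> R by rewrite invf_lt1 ?ltr1n.
(* For q = 2 ^ -m the three bounds give, in order, r ^ M <= 1 / 4, 2 r ^ M <= p q / 16 and 2 M 4 ^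
   -m <= 1 / 2. *)
pose e := Num.min 4^-1 (Num.min (p / 32) (4 * (L%:R + 1))^-1) : R.
have e0 : 0 < e by rewrite !lt_min !divr_gt0 ?invr_gt0 ?mulr_gt0 // ltr_wpDl.
have [m Hm] := exp_eventually_lt h0 h1 e0.
have {Hm} := ltW (Hm m (leqnn m)); rewrite !le_min exprVn => /andP[m4 /andP[mp mL]].
set q : R := 2 ^- m in m4 mp mL.
have q0 : 0 < q by rewrite invr_gt0 exprn_gt0.
have qq : 4 ^- m = q * q :> R.
  by rewrite /q -invfM -exprMn; congr ((_ ^+ _)^-1); ring.
have mq : m%:R * q <= 1.
  rewrite ler_pdivrMr ?exprn_gt0 // mul1r -natrX ler_nat ltnW //.
  by rewrite ltn_expl.
pose M := (L * m)%N.
have rM : r ^+ M <= q * q.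
  rewrite exprM -qq -exprVn.
  apply: lerXn2r; [exact: exprn_ge0|by rewrite nnegrE invr_ge0|exact: HL].
have rM4 : r ^+ M <= 4^-1.
  rewrite (le_trans rM) // (le_trans _ m4) // ler_piMl ?(ltW q0) //.
  by rewrite (le_trans m4) // invf_le1 ?ler1n.
have Mm : 2 * M%:R * 4 ^- m <= 1 / 2 :> R.
  rewrite qq natrM; have L0 : 0 <= L%:R :> R by [].
  have L1 : 0 < 4 * (L%:R + 1) :> R by rewrite mulr_gt0 // ltr_wpDl.
  move: mL; rewrite -[_^-1]mul1r ler_pdivlMr // => mL.
  have : L%:R * (m%:R * q) * q <= L%:R * 1 * q.
    by rewrite ler_wpM2r ?(ltW q0) // ler_wpM2l.
  lra.
(* The main term p q / 2 is 8 E, while the tail and the three errors are each made at most E. *)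
pose E := p * q / 16.
have E0 : 0 < E by rewrite divr_gt0 ?mulr_gt0.
have rME : 2 * r ^+ M <= E by rewrite /E; nra.
have A0 : 0 <= 2 * pi * D / (1 - rho).
  by rewrite divr_ge0 ?subr_ge0 ?(ltW rho1) // !mulr_ge0 // ltW.
have [k0 Hk0] := mulexp_eventually_le (ltW rho0) rho1 A0 E0.
have {}Hk0 := Hk0 k0 (leqnn k0).
have A1 : 0 <= 2 * pi * K by rewrite !mulr_ge0 // ltW.
have [k2 Hk2] := mulexp_eventually_le l0 l_lt1 A1 E0.
have {}Hk2 := Hk2 k2 (leqnn k2).
have A2 : 0 <= 4 * M%:R * (1 + 2 * K) by rewrite !mulr_ge0 // addr_ge0 // mulr_ge0.
have [Q1 HQ1] := mulexp_eventually_le l0 l_lt1 A2 E0.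
(* 4 M <= lambda ^ -Q keeps the frequency shifts caused by the localizer below w / 2. *)
have A3 : 0 <= 4 * M%:R :> R by rewrite !mulr_ge0.
have [Q2 HQ2] := mulexp_eventually_le l0 l_lt1 A3 ltr01.
pose S := (k0 + k2 + maxn Q1 Q2)%N.
(* The frequency exponent n + Q + k0 exceeds n s - k2 - 1: rounding and the margin [k2] cost only
   this fixed factor. *)
pose C := B * lambda `^ (- (k2%:R + 1) * tau).
have C0 : 0 <= C by rewrite mulr_ge0 // powR_ge0.
have E2 : 0 < E / 2 by rewrite divr_gt0.
have [n1 Hn1] := mulexp_eventually_le (ltW theta0) theta1 C0 E2.
(* The second bound gives n (s - 1) >= S + 1, hence room for [S] between n and n s. *)
pose n := maxn n1 (Num.truncn (S.+1%:R / (s - 1))).+1.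
have ns : (n + S)%:R <= n%:R * s.
  have ss : 0 < s - 1 by rewrite subr_gt0.
  have : S.+1%:R <= n%:R * (s - 1).
    rewrite -ler_pdivrMr // (le_trans (ltW (truncnS_gt _))) // ler_nat.
    exact: leq_maxr.
  rewrite natrD -natr1; lra.
have ns0 : 0 <= n%:R * s by rewrite mulr_ge0 // ltW.
set a := Num.truncn (n%:R * s).
have /andP[an na] : a%:R <= n%:R * s < a.+1%:R by exact: truncn_itv.
have aS : (n + S <= a)%N by rewrite truncn_ge_nat.
have [Q aQ QQ] : exists2 Q, a = (n + Q + k0 + k2)%N & (maxn Q1 Q2 <= Q)%N.
  exact: nat_gap aS.
have {}HQ1 := HQ1 Q (leq_trans (leq_maxl _ _) QQ).
have {}HQ2 := HQ2 Q (leq_trans (leq_maxr _ _) QQ).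
rewrite aQ in an na.
have low := localized_lower_bound l_gt0 l_lt mu_b mG K0 s1 c0 GK Gc
  D0 rho0 rho1 p0 dist_int (pk k0) an Mm.
set w := 2 * pi * lambda ^- (n + Q + k0) in low.
set phi := pi * lambda ^- k0 in low.
have lN : 0 < lambda ^- (n + Q + k0) by rewrite invr_gt0 exprn_gt0.
have w0 : 0 < w by rewrite !mulr_gt0.
have tail : \sum_(i < n) 2 ^- i.+1 * r ^+ (M * (n - i)) <= 2 ^- n * E.
  under eq_bigr do rewrite exprM.
  apply: le_trans (sum_halves_exp_le n (exprn_ge0 M r0) rM4) _.
  by rewrite ler_wpM2l ?invr_ge0 ?exprn_ge0.
have up : `|mean mu (fun x => \prod_(a <- localizer_freqs lambda b M n) cos (a * G x) ^+ 2
    * cos (w * G x - phi))| <= B * (w / 2) `^ (- tau).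
  apply: mean_prod_cos2 => // w' phi' ww'.
  have w'w : w / 2 <= `|w'|.
    have : `|w' - w| <= w / 2.
      apply: le_trans ww' _.
      apply: le_trans (ler_wpM2l _ (sum_localizer_freqs_norm M l_gt0 l_lt b0 n)) _ => //.
      have ln : 0 < lambda ^- n by rewrite invr_gt0 exprn_gt0.
      have lk0 : 1 <= lambda ^- k0 by rewrite -exprVn exprn_ege1 // invf_ge1 // ltW.
      have lQ : 0 < lambda ^- Q by rewrite invr_gt0 exprn_gt0.
      have H4 : 4 * M%:R <= lambda ^- Q.
        by rewrite -[leRHS]mul1r ler_pdivlMr ?exprn_gt0.
      have -> : w / 2 = pi * lambda ^- k0 * lambda ^- Q * lambda ^- n.
        by rewrite /w !exprD; field; rewrite !expf_neq0.
      have -> : 2 * (2 * M%:R * b * lambda ^- n) = b * (4 * M%:R) * lambda ^- n by ring.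
      rewrite ler_wpM2r ?(ltW ln) //; apply: ler_pM => //; first exact: ltW.
      apply: le_trans b1 _; have := pi_ge2 R; nra.
    rewrite ler_norml => /andP[? ?]; apply: le_trans (ler_norm _); lra.
  have w2 : 0 < w / 2 by rewrite divr_gt0.
  have w'0 : 0 < `|w'| by exact: lt_le_trans w'w.
  have w'n : w' != 0 by rewrite -normr_gt0.
  apply: le_trans (decay _ _ w'n) _; rewrite ler_wpM2l //.
  rewrite !powRN lef_pV2 ?posrE ?powR_gt0 // ge0_ler_powR ?nnegrE ?(ltW tau0) // ltW //.
have up2 : B * (w / 2) `^ (- tau) <= C * lambda `^ (s * tau) ^+ n.
  rewrite /C -mulrA ler_wpM2l //.
  apply: (@le_trans _ _ ((lambda ^+ (n + Q + k0)) `^ tau)).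
    have w20 : 0 < w / 2 by rewrite divr_gt0.
    rewrite -[- tau]mulN1r powRrM powR_inv1 ?(ltW w20) //.
    rewrite ge0_ler_powR ?nnegrE ?(ltW tau0) ?invr_ge0 ?exprn_ge0 ?(ltW w20) //.
    rewrite -[leRHS]invrK lef_pV2 ?posrE //.
    have -> : w / 2 = pi * lambda ^- (n + Q + k0) by rewrite /w mulrAC [2 * pi]mulrC mulfK.
    by rewrite ler_peMl ?(ltW lN) // (le_trans _ (pi_ge2 R)) // ler1n.
  rewrite -!powR_mulrn ?powR_ge0 // -!powRrM -powRD ?ln0 ?implybT //.
  apply: ger_powR; first by rewrite l_gt0 ltW.
  move: na; rewrite -natr1 natrD => na; nra.
have n2 : 0 < 2 ^- n :> R by rewrite invr_gt0 exprn_gt0.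
have final : 2 ^- n * E <= C * lambda `^ (s * tau) ^+ n.
  apply: le_trans up2; apply: le_trans up; apply: le_trans low.
  rewrite -/r -/b lerBrDr; apply: le_trans (lerD (lexx _) tail) _.
  rewrite -mulrDr ler_wpM2l ?(ltW n2) //.
  have -> : p * 2 ^- m / 2 = 8 * E by rewrite /E -/q; field.
  rewrite -(addrA (_ * lambda ^+ Q)); move: Hk0; rewrite mulrAC; lra.
(* Times 2 ^ n, [final] reads E <= C theta ^ n, whereas [n] was chosen with C theta ^ n <= E / 2. *)
have := Hn1 n (leq_maxl _ _); rewrite /theta exprMn.
have : E <= C * (2 ^+ n * lambda `^ (s * tau) ^+ n).
  have := ler_wpM2l (exprn_ge0 n (ler0n R 2)) final.
  by rewrite mulVKf ?expf_neq0 ?pnatr_eq0 // mulrCA.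
lra.
Qed.

(** * Calculus on the unit interval *)

Section derivatives_on_unit_interval.
Variable R : realType.
Implicit Types (f : R -> R) (x y z : R).
Local Notation I01 := (`[0, 1]%classic : set R).

Lemma derive_on_dist (A : set R) f x (e : R) : derivable_on A f -> A x -> 0 < e ->
  exists2 d : R, 0 < d & forall y, A y -> y != x -> `|y - x| < d ->
    `|derive_on A f x - diff_quotient f x y| < e.
Proof.
move=> df Ax e0; have /cvgrPdist_lt/(_ e e0) := df x Ax.
rewrite /within /= => /nbhs_ballP [d d0 Hd]; exists d => // y Ay yx yd.
by apply: Hd => //; rewrite /ball /= distrC.
Qed.

Lemma derivable_on_dist (A : set R) f x (e : R) : derivable_on A f -> A x -> 0 < e ->
  exists2 d : R, 0 < d & forall y, A y -> `|y - x| < d -> `|f y - f x| < e.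
Proof.
move=> df Ax e0; have [d d0 Hd] := derive_on_dist df Ax ltr01.
set l := derive_on A f x in Hd.
have L0 : 0 < `|l| + 1 by rewrite ltr_wpDl.
exists (Num.min d (e / (`|l| + 1))) => [|y Ay]; first by rewrite lt_min d0 divr_gt0.
rewrite lt_min => /andP[yd ye]; have [->|yx] := eqVneq y x; first by rewrite subrr normr0.
have yx0 : y - x != 0 by rewrite subr_eq0.
have -> : f y - f x = diff_quotient f x y * (y - x) by rewrite /diff_quotient divfK.
rewrite normrM; move: ye; rewrite ltr_pdivlMr //; apply: le_lt_trans.
rewrite mulrC ler_wpM2l //.
have := Hd y Ay yx yd; have := ler_normD (diff_quotient f x y - l) l.
by rewrite subrK distrC; lra.
Qed.

Lemma derivable_on_is_derive f x : derivable_on I01 f -> 0 < x -> x < 1 ->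
  is_derive x 1 f (derive_on I01 f x).
Proof.
move=> df x0 x1; have Ax : I01 x by rewrite /= in_itv /= !ltW.
set l := derive_on I01 f x.
suff H : (fun h : R => h^-1 *: (f (h *: 1 + x) - f x)) @ 0^' --> l.
  apply: DeriveDef; first by apply/cvg_ex; exists l.
  exact: cvg_lim H.
apply/cvgrPdist_lt => e e0; have [d d0 Hd] := derive_on_dist df Ax e0.
rewrite /dnbhs /within /=; apply/nbhs_ballP.
exists (Num.min d (Num.min x (1 - x))); first by rewrite /= !lt_min d0 x0 subr_gt0.
move=> h; rewrite /ball /= sub0r normrN !lt_min => /andP[hd /andP[hx hx1]] h0.
have xh : h *: 1 + x = x + h by rewrite /GRing.scale /= mulr1 addrC.
have := Hd (x + h); rewrite [x + h - x]addrC addKr /diff_quotient => H.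
rewrite xh /GRing.scale /= mulrC -{2}(addKr x h) [- x + _]addrC; apply: H => //.
- move: hx hx1; rewrite !ltr_norml => /andP[? ?] /andP[? ?].
  by rewrite /= in_itv /=; apply/andP; split; lra.
- by rewrite -subr_eq0 [x + h]addrC addrK.
Qed.

Lemma derivable_on_continuous f x y : derivable_on I01 f -> 0 <= x -> y <= 1 ->
  {within `[x, y], continuous f}.
Proof.
move=> df x0 y1; apply/(@subspace_continuousP _ _ _ _) => z /=.
rewrite in_itv /= => /andP[xz zy].
have Az : I01 z by rewrite /= in_itv /= (le_trans x0) // (le_trans zy).
apply/cvgrPdist_lt => e e0; have [d d0 Hd] := derivable_on_dist df Az e0.
rewrite /within /=; apply/nbhs_ballP; exists d => // t zt.
rewrite in_itv /= => /andP[xt ty]; rewrite distrC; apply: Hd.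
  by rewrite /= in_itv /= (le_trans x0) // (le_trans ty).
by move: zt; rewrite /ball /= distrC.
Qed.

Lemma derivable_on_MVT f x y : derivable_on I01 f -> 0 <= x -> x < y -> y <= 1 ->
  exists2 z, x < z < y & f y - f x = derive_on I01 f z * (y - x).
Proof.
move=> df x0 xy y1.
have [z|z zI E] := @MVT R f (derive_on I01 f) x y xy _ (derivable_on_continuous df x0 y1).
  rewrite in_itv /= => /andP[xz zy].
  by apply: derivable_on_is_derive => //; [exact: le_lt_trans xz|exact: lt_le_trans zy _].
by exists z => //; move: zI; rewrite in_itv.
Qed.

(** All that is retained of the attractor: a value taken at points accumulating at 0 from the right,
    a property that Rolle's theorem passes on to derivatives. *)
Definition attained_near0 f v := forall e : R, 0 < e ->
  exists z, [/\ 0 < z, z < e, z <= 1 & f z = v].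

Lemma attained_near0_derive f v : derivable_on I01 f -> attained_near0 f v ->
  attained_near0 (derive_on I01 f) 0.
Proof.
move=> df acc e e0; have [y [y0 ye y1 fy]] := acc e e0.
have [x [x0 xy x1 fx]] := acc y y0.
have [z /andP[xz zy]] := derivable_on_MVT df (ltW x0) xy y1.
rewrite fx fy subrr => /esym/eqP.
rewrite mulf_eq0 subr_eq0 (gt_eqF xy) orbF => /eqP fz.
exists z; split=> //; first exact: lt_trans xz.
  exact: lt_trans ye.
by rewrite (le_trans (ltW zy)).
Qed.

Lemma attained_near0_value f v : {within I01, continuous f} -> attained_near0 f v ->
  f 0 = v.
Proof.
move=> cf acc; apply/eqP; rewrite -subr_eq0 -normr_eq0 eq_le normr_ge0 andbT.
apply/ler_addgt0Pl => e e0; rewrite addr0.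
have A0 : I01 0 by rewrite /= in_itv /= lexx ler01.
have /(subspace_continuousP I01 f)/(_ 0 A0)/cvgrPdist_lt/(_ e e0) := cf.
rewrite /within /= => /nbhs_ballP [d d0 Hd].
have [z [z0 zd z1 <-]] := acc d d0; apply/ltW/Hd.
  by rewrite /ball /= sub0r normrN gtr0_norm.
by rewrite in_itv /= ltW.
Qed.

Lemma taylor_step f (w K a : R) : derivable_on I01 f -> 0 <= K -> 0 <= a ->
  (forall x, 0 <= x <= 1 -> `|derive_on I01 f x - w| <= K * x `^ a) ->
  forall x, 0 <= x <= 1 -> `|f x - f 0 - w * x| <= K * x `^ (a + 1).
Proof.
move=> df K0 a0 H x /andP[x0 x1].
have [->|xn0] := eqVneq x 0.
  by rewrite mulr0 subr0 subrr normr0 mulr_ge0 // powR_ge0.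
have xp : 0 < x by rewrite lt_def xn0.
have [z /andP[z0 zx]] := derivable_on_MVT df (lexx 0) xp x1.
rewrite subr0 => ->; rewrite -mulrBl normrM (ger0_norm x0).
rewrite powRD ?xn0 ?implybT // powRr1 // mulrA ler_wpM2r //.
have z01 : 0 <= z <= 1 by rewrite (ltW z0) (le_trans (ltW zx)).
apply: le_trans (H z z01) _; rewrite ler_wpM2l // ge0_ler_powR ?nnegrE //.
  exact: ltW.
exact: ltW.
Qed.

(** Descent from order [r]: the Hoelder bound controls [D r], and each [taylor_step] gains one power
    of x because [D j] vanishes at 0 for 2 <= j <= r. The last step, to [D 0], has slope [eta]
    instead. *)
Lemma holder_taylor (r : nat) (alpha eta : R) f : (1 <= r)%N -> 0 < alpha ->
  Cn_holder_on I01 r alpha f -> attained_near0 (derive_on I01 f) eta ->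
  exists2 K : R, 0 <= K & forall x, 0 <= x <= 1 ->
    `|f x - f 0 - eta * x| <= K * x `^ (r%:R + alpha).
Proof.
move=> r1 a0 [[df cf] [K0 HK]] acc.
have [D [D0 DS]] : exists D : nat -> R -> R, D = deriven_on I01 ^~ f /\
  forall k, D k.+1 = derive_on I01 (D k) by exists (deriven_on I01 ^~ f).
have Df : D 0%N = f by rewrite D0.
have Dr : D r = deriven_on I01 r f by rewrite D0.
have dfD k : (k < r)%N -> derivable_on I01 (D k) by rewrite D0; exact: df.
rewrite -Dr in cf HK; rewrite -Df -DS in acc.
clear df D0 Dr.
have accD k : (k.+2 <= r)%N -> attained_near0 (D k.+2) 0.
  elim: k => [|k IHk] kr; rewrite DS.
    exact: (@attained_near0_derive (D 1%N) eta (dfD 1%N kr) acc).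
  exact: (@attained_near0_derive (D k.+2) 0 (dfD k.+2 kr) (IHk (ltnW kr))).
have A0 : I01 0 by rewrite /= in_itv /= lexx ler01.
have contD k : (k <= r)%N -> {within I01, continuous (D k)}.
  rewrite leq_eqVlt => /orP[/eqP->//|kr].
  by apply: derivable_on_continuous => //; exact: dfD.
have D1 : D 1%N 0 = eta by apply: attained_near0_value acc; exact: contD.
have D2 k : (k.+2 <= r)%N -> D k.+2 0 = 0.
  by move=> kr; apply: attained_near0_value (accD k kr); exact: contD.
pose K := `|K0|; have K_ge0 : 0 <= K by exact: normr_ge0.
have claim k : (k < r)%N -> forall x, 0 <= x <= 1 ->
    `|D (r - k)%N x - D (r - k)%N 0| <= K * x `^ (k%:R + alpha).
  elim: k => [|k IHk] kr x x01.
    rewrite subn0 add0r; have Ax : I01 x by rewrite /= in_itv.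
    apply: le_trans (HK x 0 Ax A0) _; rewrite subr0.
    have /andP[x0 _] := x01; rewrite (ger0_norm x0).
    by rewrite ler_wpM2r ?powR_ge0 // ler_norm.
  have [j Ej] : exists j, (r - k = j.+2)%N by exists (r - k.+2)%N; lia.
  have Ej1 : (r - k.+1 = j.+1)%N by lia.
  have jr : (j.+2 <= r)%N by rewrite -Ej leq_subr.
  have := IHk (ltnW kr); rewrite Ej Ej1 => IH.
  have H y : 0 <= y <= 1 -> `|derive_on I01 (D j.+1) y - 0| <= K * y `^ (k%:R + alpha).
    by move=> y01; rewrite -DS subr0 -[D _ y]subr0 -(D2 j jr); exact: IH.
  have ka : 0 <= k%:R + alpha by rewrite addr_ge0 // ltW.
  have := taylor_step (dfD j.+1 jr) K_ge0 ka H x01.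
  by rewrite mul0r subr0 [k%:R + alpha + 1]addrAC natr1.
exists K => // x x01.
have H y : 0 <= y <= 1 -> `|derive_on I01 (D 0%N) y - eta| <= K * y `^ (r.-1%:R + alpha).
  have r1r : (r.-1 < r)%N by rewrite prednK.
  move=> y01; have := claim r.-1 r1r y y01.
  have -> : (r - r.-1 = 1)%N by lia.
  by rewrite D1 -DS.
have ra : 0 <= r.-1%:R + alpha by rewrite addr_ge0 // ltW.
have := taylor_step (dfD 0%N r1) K_ge0 ra H x01.
by rewrite Df [_ + alpha + 1]addrAC natr1 prednK.
Qed.

(** Up to [x0], where K x ^ (s - 1) <= 1 / 2, the linear term dominates; on [x0, 1] the modulus has
    a positive minimum by compactness. *)
Lemma positive_slope_bound f (K s : R) : {within I01, continuous f} ->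
  0 <= K -> 1 < s -> (forall x, 0 <= x <= 1 -> `|f x - x| <= K * x `^ s) ->
  (forall x, 0 < x <= 1 -> f x != 0) ->
  exists2 c : R, 0 < c & forall x, 0 <= x <= 1 -> c * x <= `|f x|.
Proof.
move=> cf K0 s1 Hf f0.
have K1 : 0 < 2 * (K + 1) by rewrite mulr_gt0 // ltr_wpDl.
have s10 : 0 < s - 1 by rewrite subr_gt0.
pose x0 := (2 * (K + 1))^-1 `^ (s - 1)^-1.
have x0_gt0 : 0 < x0 by rewrite powR_gt0 // invr_gt0.
have x0s : x0 `^ (s - 1) = (2 * (K + 1))^-1.
  by rewrite -powRrM mulVf ?gt_eqF // powRr1 // invr_ge0 ltW.
have small x : 0 <= x <= 1 -> x <= x0 -> 2^-1 * x <= `|f x|.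
  move=> x01 xx0; have /andP[x_ge0 _] := x01.
  have [->|xn0] := eqVneq x 0; first by rewrite mulr0 normr_ge0.
  have : K * x `^ s <= 2^-1 * x.
    have -> : x `^ s = x `^ (s - 1) * x.
      by rewrite -{3}(powRr1 x_ge0) -powRD ?xn0 ?implybT // subrK.
    rewrite mulrA ler_wpM2r //.
    have : x `^ (s - 1) <= (2 * (K + 1))^-1.
      by rewrite -x0s ge0_ler_powR ?nnegrE // ltW.
    rewrite -[_^-1]mul1r ler_pdivlMr // => H.
    by have := powR_ge0 x (s - 1); nra.
  have := Hf x x01; rewrite ler_norml => /andP[? ?] ?.
  by apply: le_trans (ler_norm _); lra.
have [x01|x01] := leP x0 1; last first.
  exists 2^-1 => [|x x1]; first by rewrite invr_gt0.
  by apply: small => //; have /andP[_ /le_trans] := x1; apply; exact: ltW.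
have cfn : {within `[x0, 1], continuous (fun x => `|f x|)}.
  move=> x; apply: continuous_comp; last exact: norm_continuous.
  apply: continuous_subspaceW cf x => y /=; rewrite !in_itv /= => /andP[xy ->].
  by rewrite (le_trans (ltW x0_gt0)).
have [m mI Hm] := EVT_min x01 cfn.
have fm : 0 < `|f m|.
  rewrite normr_gt0 f0 //; move: mI; rewrite in_itv /= => /andP[xm ->].
  by rewrite (lt_le_trans x0_gt0).
exists (Num.min 2^-1 `|f m|) => [|x x1]; first by rewrite lt_min invr_gt0 ltr0n.
have /andP[x_ge0 x_le1] := x1; have [xx0|xx0] := leP x x0.
  apply: le_trans (small x x1 xx0); rewrite ler_wpM2r //.
  by rewrite ge_min lexx.
apply: (@le_trans _ _ `|f m|); last by apply: Hm; rewrite in_itv /= (ltW xx0).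
rewrite (@le_trans _ _ (`|f m| * x)) ?ler_piMr ?ler_wpM2r //.
by rewrite ge_min lexx orbT.
Qed.

(** The next derivative is bounded on the compact interval; this makes alpha = 1 available at every
    order. *)
Lemma Cn_on_lipschitz f n : Cinfty_on I01 f -> holder_on I01 1 (deriven_on I01 n f).
Proof.
move=> Cf; have [df cf] := Cf n.+1.
have dfn : derivable_on I01 (deriven_on I01 n f) by exact: df.
have [M _ HM] := EVT_max ler01 cf; have [m _ Hm] := EVT_min ler01 cf.
set g := deriven_on I01 n f in dfn *; set g' := deriven_on I01 n.+1 f in HM Hm.
exists (`|g' M| + `|g' m|) => x y.
wlog xy : x y / x <= y => [H Ax Ay|].
  have [/H|/ltW/H] := leP x y; first exact.
  by rewrite distrC (distrC y); apply.
rewrite /= !in_itv /= => /andP[x0 x1] /andP[y0 y1].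
rewrite powRr1 ?normr_ge0 //; have [->|xny] := eqVneq x y.
  by rewrite !subrr !normr0 mulr0.
have xlty : x < y by rewrite lt_neqAle xny.
have [z /andP[xz zy] E] := derivable_on_MVT dfn x0 xlty y1.
rewrite distrC E normrM distrC ler_wpM2r //.
have zI : z \in `[0, 1].
  by rewrite in_itv /= (le_trans x0 (ltW xz)) (le_trans (ltW zy)).
have := HM z zI; have := Hm z zI; rewrite -/g'.
have := ler_norm (g' M); have := ler_norm (- g' m); rewrite normrN.
have := normr_ge0 (g' M); have := normr_ge0 (g' m).
rewrite -[derive_on _ _ z]/(g' z) ler_norml => *; apply/andP; split; lra.
Qed.

Lemma diffeo_on_injective f : diffeo_on I01 f ->
  forall x, 0 < x <= 1 -> f x != f 0.
Proof.
move=> [_ [g [_ gf]]] x /andP[x0 x1]; apply/eqP => fx.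
have A0 : I01 0 by rewrite /= in_itv /= lexx ler01.
have Ax : I01 x by rewrite /= in_itv /= (ltW x0).
by move: x0; rewrite -(gf x Ax) fx (gf 0 A0) ltxx.
Qed.

(** Difference quotients of the inverse at f 0 are eventually below |l| + 1 in modulus, so those of
    [f] at 0 cannot tend to 0. *)
Lemma diffeo_on_derive_neq0 f : diffeo_on I01 f -> derive_on I01 f 0 != 0.
Proof.
move=> fd; have inj := diffeo_on_injective fd.
have [[df _] [g [[dg _] gf]]] := fd; apply/eqP => f0.
have {}df : derivable_on I01 f by exact: (df 0%N).
have {}dg : derivable_on (f @` I01) g by exact: (dg 0%N).
have A0 : I01 0 by rewrite /= in_itv /= lexx ler01.
have B0 : (f @` I01) (f 0) by exists 0.
have [d d0 Hd] := derive_on_dist dg B0 ltr01.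
set l := derive_on _ g (f 0) in Hd.
have L0 : 0 < `|l| + 1 by rewrite ltr_wpDl.
have [d1 d10 Hd1] := derivable_on_dist df A0 d0.
have i0 : 0 < (`|l| + 1)^-1 by rewrite invr_gt0.
have [d2 d20 Hd2] := derive_on_dist df A0 i0.
pose y := Num.min 1 (Num.min (d1 / 2) (d2 / 2)).
have y0 : 0 < y by rewrite !lt_min ltr01 !divr_gt0.
have [y1 yd1 yd2] : [/\ y <= 1, y < d1 & y < d2].
  have : y <= Num.min 1 (Num.min (d1 / 2) (d2 / 2)) by exact: lexx.
  rewrite !le_min => /andP[? /andP[? ?]]; split=> //; lra.
have Ay : I01 y by rewrite /= in_itv /= (ltW y0).
have fy : f y != f 0 by apply: inj; rewrite y0.
have By : (f @` I01) (f y) by exists y.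
have := Hd (f y) By fy; rewrite /diff_quotient (gf y Ay) (gf 0 A0) subr0.
have := Hd1 y Ay; have := Hd2 y Ay; rewrite /diff_quotient !subr0 f0 sub0r normrN.
rewrite (gtr0_norm y0) (gt_eqF y0) => /(_ isT yd2) H2 /(_ yd1) H1 /(_ H1) H.
have u0 : 0 < `|f y - f 0| by rewrite normr_gt0 subr_eq0.
have H3 : y / `|f y - f 0| < `|l| + 1.
  have := ler_normD (y / (f y - f 0) - l) l; rewrite subrK distrC.
  by rewrite normrM normfV (gtr0_norm y0); move: H; lra.
move: H2 H3; rewrite normrM normfV (gtr0_norm y0) !ltr_pdivrMr // => H2.
rewrite -ltr_pdivrMl // => /lt_trans/(_ H2).
by rewrite ltxx.
Qed.

End derivatives_on_unit_interval.

(** * The attractor and the push-forward measure *)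

Section attractor.
Variables (R : realType) (lambda : R) (X : set R).
Hypotheses (lambda_gt0 : 0 < lambda) (lambda_lt1 : lambda < 1).
Hypothesis X_attractor : is_attractor lambda X.

Lemma attractor_e0 n (x : R) : X x -> X (lambda ^+ n * x).
Proof.
have [_ _ XE] := X_attractor; elim: n => [|n IHn] Xx; first by rewrite mul1r.
by rewrite XE; left; exists (lambda ^+ n * x); [exact: IHn|rewrite /e0 mulrA exprS].
Qed.

Lemma attractor0 : X 0.
Proof.
have [[x Xx] cX _] := X_attractor.
have clX : closed X by apply: compact_closed cX; exact: Rhausdorff.
have c0 : (fun n => lambda ^+ n * x) @ \oo --> (0 : R).
  rewrite -[X in _ --> X](mul0r x); apply: cvgM; last exact: cvg_cst.
  by apply: cvg_expr; rewrite gtr0_norm.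
apply: (closed_cvg X clX _ _ c0).
by apply: nearW => n; exact: attractor_e0.
Qed.

Lemma attractor_attained_near0 (f : R -> R) (eta : R) :
  (forall x, X x -> f x = eta) -> attained_near0 f eta.
Proof.
move=> fX e e0; have [_ _ XE] := X_attractor.
have X1 : X (1 - lambda).
  by rewrite XE; right; exists 0; [exact: attractor0|rewrite /e1 mulr0 add0r].
have l0 := ltW lambda_gt0; have l1 : 0 < 1 - lambda by rewrite subr_gt0.
have [N HN] := exp_eventually_lt l0 lambda_lt1 e0.
have lN : 0 < lambda ^+ N by rewrite exprn_gt0.
exists (lambda ^+ N * (1 - lambda)); split.
- by rewrite mulr_gt0.
- by apply: le_lt_trans (HN N (leqnn N)); rewrite ler_piMr ?(ltW lN) // gerBl.
- by rewrite mulr_ile1 ?(ltW lN) ?(ltW l1) ?gerBl // exprn_ile1 // ltW.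
- by apply: fX; exact: attractor_e0.
Qed.

End attractor.

Section pushforward_fourier.
Variables (R : realType) (mu : probability (measurableTypeR R) R).
Local Notation I01 := (`[0, 1]%classic : set R).
Implicit Types h : R -> R.

Lemma measurable_restrict01 h : {within I01, continuous h} ->
  measurable_fun [set: measurableTypeR R] (h \_ I01).
Proof.
move=> ch; apply/(measurable_restrictT _ _).1 => //.
exact: subspace_continuous_measurable_fun.
Qed.

Lemma fourier_pushforward01 h (xi : R) :
  measurable_fun [set: measurableTypeR R] (h \_ I01) ->
  fourier (pushforward01 mu h) xi =
    (mean mu (fun x => cos (2 * pi * xi * (h \_ I01) x))
     +i* - mean mu (fun x => sin (2 * pi * xi * (h \_ I01) x)))%C.
Proof.
move=> mh.
have mphi : measurable_fun [set: measurableTypeR R]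
    (h \_ I01 : measurableTypeR R -> measurableTypeR R) by exact: mh.
have push (f : R -> R) : bounded_measurable f ->
    fine (\int[pushforward01 mu h]_t (f t)%:E) = mean mu (fun x => f ((h \_ I01) x)).
  move=> bf; rewrite /mean /Rintegral; congr fine.
  have [mf _] := bf.
  apply: (integral_pushforward mphi) => //.
    exact/measurable_EFinP.
  rewrite preimage_setT.
  exact: (bounded_measurable_integrable mu (bounded_measurable_comp mphi bf)).
have bc (a : R) : bounded_measurable (fun t => cos (- (a * t))).
  by apply: bounded_measurable_cos; apply: measurable_funN; exact: measurable_funM.
have bs (a : R) : bounded_measurable (fun t => sin (- (a * t))).
  have -> : (fun t => sin (- (a * t))) = fun t => cos (- (a * t) - pi / 2).
    by apply/funext => t; rewrite cosBpihalf.
  apply: bounded_measurable_cos; apply: measurable_funB => //.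
  by apply: measurable_funN; exact: measurable_funM.
rewrite /fourier /Cintegral /expi /= (push _ (bc _)) (push _ (bs _)).
congr (_ +i* _)%C.
  by congr (mean _ _); apply/funext => x; rewrite cosN.
rewrite -mulN1r -meanZ.
  by congr (mean _ _); apply/funext => x; rewrite sinN mulN1r.
have := bounded_measurable_comp mphi (bs (- (2 * pi * xi))).
suff -> : (fun x => sin (2 * pi * xi * (h \_ I01) x)) =
  (fun x => sin (- (- (2 * pi * xi) * (h \_ I01) x))) by [].
by apply/funext => x; rewrite mulNr opprK.
Qed.

(** Real and imaginary parts bound the cosine and sine means at xi = w / (2 pi eta); a cosine of
    arbitrary phase combines the two, whence the factor 2. *)
Lemma fourier_decay_mean_cos h (tau C h0 eta : R) :
  measurable_fun [set: measurableTypeR R] (h \_ I01) -> eta != 0 -> 0 <= C ->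
  fourier_decay (pushforward01 mu h) tau C ->
  forall w phi : R, w != 0 ->
    `|mean mu (fun x => cos (w * (((h \_ I01) x - h0) / eta) - phi))|
      <= 2 * C * `|2 * pi * eta| `^ tau * `|w| `^ (- tau).
Proof.
move=> mh eta0 C0 decay w phi w0; have pi0 := pi_gt0 R.
have e2 : 2 * pi * eta != 0 by rewrite !mulf_neq0 ?pnatr_eq0 // gt_eqF.
pose xi := w / (2 * pi * eta).
have xi0 : xi != 0 by rewrite /xi mulf_neq0 // invr_eq0.
have := decay xi xi0; rewrite fourier_pushforward01 //.
set c := mean _ _; set s := mean _ _ => H.
have [Hc Hs] : `|c| <= C * `|xi| `^ (- tau) /\ `|s| <= C * `|xi| `^ (- tau).
  move: H; rewrite normc_def lecR /= sqrrN => H; split; apply: le_trans H.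
    by rewrite -sqrtr_sqr ler_sqrt ?lerDl ?addr_ge0 ?sqr_ge0.
  by rewrite -sqrtr_sqr ler_sqrt ?lerDr ?addr_ge0 ?sqr_ge0.
have xiE : `|xi| `^ (- tau) = `|2 * pi * eta| `^ tau * `|w| `^ (- tau).
  rewrite /xi normrM normfV powRM ?invr_ge0 ?normr_ge0 // mulrC; congr (_ * _).
  by rewrite -powR_inv1 ?normr_ge0 // -powRrM mulrNN mul1r.
pose psi := w * h0 / eta + phi.
have bcos : bounded_measurable (fun x => cos (2 * pi * xi * (h \_ I01) x)).
  by apply: bounded_measurable_cos; exact: measurable_funM.
have bsin : bounded_measurable (fun x => sin (2 * pi * xi * (h \_ I01) x)).
  have -> : (fun x => sin (2 * pi * xi * (h \_ I01) x)) =
      fun x => cos (2 * pi * xi * (h \_ I01) x - pi / 2).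
    by apply/funext => x; rewrite cosBpihalf.
  by apply: bounded_measurable_cos; apply: measurable_funB => //; exact: measurable_funM.
have -> : (fun x => cos (w * (((h \_ I01) x - h0) / eta) - phi)) =
    fun x => cos psi * cos (2 * pi * xi * (h \_ I01) x)
           + sin psi * sin (2 * pi * xi * (h \_ I01) x).
  apply/funext => x; rewrite -cosB -cosN; congr cos; rewrite /psi /xi.
  have : (pi : R) != 0 by rewrite gt_eqF.
  by generalize (pi : R) => p pn; field; rewrite eta0.
rewrite meanD; [|exact: bounded_measurableZ|exact: bounded_measurableZ].
rewrite !meanZ // -/c -/s (le_trans (ler_normD _ _)) // -[leRHS]mulrA -xiE -[leRHS]mulrA.
rewrite -[2]/(1 + 1 : R) mulrDl mul1r (normrM (cos psi)) (normrM (sin psi)); apply: lerD.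
  by apply: le_trans Hc; rewrite ler_piMl // cos_max.
by apply: le_trans Hs; rewrite ler_piMl // sin_max.
Qed.

End pushforward_fourier.

Lemma exponent_le_of_derive_const (R : realType) (lambda : R) (X : set R)
    (mu : probability (measurableTypeR R) R) (r : nat) (alpha : R) (h : R -> R)
    (eta tau C : R) :
  0 < lambda -> lambda < 1 / 2 -> pisot lambda^-1 ->
  is_attractor lambda X -> is_bernoulli_convolution lambda mu ->
  (1 <= r)%N -> 0 < alpha ->
  Cn_holder_on `[0, 1] r alpha h -> diffeo_on `[0, 1] h ->
  (forall x, X x -> derive_on `[0, 1] h x = eta) -> eta != 0 ->
  0 < tau -> 0 < C -> fourier_decay (pushforward01 mu h) tau C ->
  tau <= ln 2 / (- ln lambda * (r%:R + alpha)).
Proof.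
move=> l_gt0 l_lt lp XA mub r1 a0 hr hd hX eta0 tau0 C0 decay.
have l_lt1 : lambda < 1 by apply: lt_trans l_lt _; lra.
have acc := attractor_attained_near0 l_gt0 l_lt1 XA hX.
have [K K0 HK] := holder_taylor r1 a0 hr acc.
have ch : {within `[0, 1], continuous h}.
  have [[[dh _] _] _] := (hd, I); apply: derivable_on_continuous => //.
  exact: (dh 0%N).
have mh := measurable_restrict01 ch.
(* [G] is normalized to be tangent to the identity at 0, for either sign of [eta]. *)
pose H := h \_ `[0, 1]; pose G x := (H x - h 0) / eta.
have HE x : 0 <= x <= 1 -> H x = h x.
  by move=> x01; rewrite /H patchE mem_set //= in_itv.
have s1 : 1 < r%:R + alpha.
  by rewrite (@lt_le_trans _ _ (1 + alpha)) ?ltrDl // lerD2r ler1n.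
have GK x : 0 <= x <= 1 -> `|G x - x| <= K / `|eta| * x `^ (r%:R + alpha).
  move=> x01; rewrite /G HE //.
  have -> : (h x - h 0) / eta - x = (h x - h 0 - eta * x) / eta by field.
  rewrite normrM normfV mulrAC ler_wpM2r ?invr_ge0 //; exact: HK.
have K0' : 0 <= K / `|eta| by rewrite divr_ge0.
have cG : {within `[0, 1], continuous (fun x => (h x - h 0) / eta)}.
  move=> x; apply: cvgM; last exact: cvg_cst.
  by apply: cvgB; [exact: ch|exact: cvg_cst].
have [c c0 Hc] : exists2 c : R, 0 < c & forall x, 0 <= x <= 1 -> c * x <= `|G x|.
  have [|x /andP[x0 x1]|c c0 Hc] := positive_slope_bound cG K0' s1.
  - by move=> x x01; have := GK x x01; rewrite /G HE.
  - rewrite mulf_neq0 ?invr_eq0 // subr_eq0; apply: diffeo_on_injective => //.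
    by rewrite x0.
  - by exists c => // x x01; rewrite /G HE //; exact: Hc.
have mG : measurable_fun [set: measurableTypeR R] G.
  by apply: measurable_funM => //; exact: measurable_funB.
apply: (decay_exponent_bound l_gt0 l_lt lp mub mG K0' s1 c0 GK Hc tau0 _
  (fourier_decay_mean_cos (h 0) mh eta0 (ltW C0) decay)).
by rewrite !mulr_ge0 ?powR_ge0 // ltW.
Qed.

Theorem proposition9 (R : realType) (lambda : R) (X : set R)
    (mu : probability (measurableTypeR R) R)
    (lambda_gt0 : 0 < lambda) (lambda_lt : lambda < 1 / 2)
    (lambda_pisot : pisot lambda^-1)
    (X_attractor : is_attractor lambda X)
    (mu_bernoulli : is_bernoulli_convolution lambda mu) :
  (forall (r : nat) (alpha s : R) (h : R -> R) (eta tau C : R),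
     (1 <= r)%N -> 0 < alpha -> alpha <= 1 -> s = r%:R + alpha -> 1 < s ->
     Cn_holder_on `[0, 1] r alpha h -> diffeo_on `[0, 1] h ->
     (forall x, X x -> derive_on `[0, 1] h x = eta) -> eta != 0 ->
     0 < tau -> 0 < C ->
     fourier_decay (pushforward01 mu h) tau C ->
     tau <= ln 2 / (- ln lambda * s)) /\
  (forall h : R -> R,
     Cinfty_on `[0, 1] h -> diffeo_on `[0, 1] h ->
     (exists c : R, forall x, X x -> derive_on `[0, 1] h x = c) ->
     ~ polynomial_fourier_decay (pushforward01 mu h)).
Proof.
split=> [r alpha s h eta tau C r1 a0 _ -> _ hr hd hX eta0 tau0 C0 decay|].
  exact: exponent_le_of_derive_const hX eta0 tau0 C0 decay.
move=> h hinf hd [c hX] [tau [C [tau0 C0 decay]]].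
have l_lt1 : lambda < 1 by apply: lt_trans lambda_lt _; lra.
have c0 : c != 0.
  rewrite -(hX 0); first exact: diffeo_on_derive_neq0.
  exact: attractor0 X_attractor.
(* With alpha = 1 every order [r] is admissible, and the bound tends to 0. *)
have bound r : (1 <= r)%N -> tau <= ln 2 / (- ln lambda * (r%:R + 1)).
  move=> r1; apply: (exponent_le_of_derive_const (alpha := 1)) hX c0 tau0 C0 decay => //.
  by split; [exact: hinf|exact: Cn_on_lipschitz].
have lnl : 0 < - ln lambda by rewrite oppr_gt0 ln_lt0 // lambda_gt0.
(* The bound at order r amounts to r + 1 <= q, which fails for r one more than the integer part of
   [q]. *)
pose q := ln 2 / (- ln lambda * tau).
have := bound (Num.truncn q).+1 isT.
have r0 : 0 < (Num.truncn q).+1%:R + 1 :> R by rewrite ltr_wpDl.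
rewrite ler_pdivlMr ?mulr_gt0 //; apply/negP; rewrite -ltNge.
rewrite mulrA [tau * _]mulrC -ltr_pdivrMl ?mulr_gt0 // [ltLHS]mulrC -/q.
by apply: lt_trans (truncnS_gt q) _; rewrite ltrDl.
Qed.
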